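(* Let $k \geq 2$ be an integer and let $G$ be a $k$-connected $(K_2 \cup kK_1)$-free graph with $\delta(G) \geq \frac{3(k-1)}{2}$ and $\alpha(G) \leq \frac{|V(G)|}{2}$. Then $G$ is hamiltonian or $G$ is the Petersen graph.
   Context: All graphs are finite, undirected and simple. $\delta(G)$ denotes the minimum degree and $\alpha(G)$ the independence number of $G$. For graphs $R, R'$, $R \cup R'$ is their disjoint union and $kR$ is the disjoint union of $k$ copies of $R$; $K_n$ is the complete graph on $n$ vertices. A graph $G$ is $R$-free if it contains no induced subgraph isomorphic to $R$. A graph is hamiltonian if it contains a spanning cycle. *)

(* Defs.v *)
From mathcomp Require Import all_boot.
Set Implicit Arguments. Unset Strict Implicit. Unset Printing Implicit Defensive.

Section Graphs.
Variable T : finType.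
Implicit Types (e : rel T) (S : {set T}).

Definition simple_graph e := symmetric e /\ irreflexive e.

Definition connected_without e S :=
  forall x y, x \notin S -> y \notin S ->
    connect [rel u v | [&& e u v, u \notin S & v \notin S]] x y.

Definition k_connected (k : nat) e :=
  k < #|T| /\ forall S, #|S| < k -> connected_without e S.

Definition deg e v := #|[set w | e v w]|.

(* minimum degree delta(G) (T nonempty in our uses) *)
Definition min_degree e := \max_(d < #|T|.+1 | [forall v, d <= deg e v]) d.

Definition independent e S := [forall x in S, forall y in S, ~~ e x y].

Definition alpha e := \max_(S : {set T} | independent e S) #|S|.

Definition has_induced_K2_kK1 (k : nat) e :=
  exists u v (W : {set T}),
    [/\ e u v, (u \notin W) && (v \notin W), #|W| = k,
        independent e W & (forall w, w \in W -> ~~ e u w && ~~ e v w)].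

Definition K2_kK1_free k e := ~ has_induced_K2_kK1 k e.

Definition hamiltonian e :=
  exists s : seq T, [/\ uniq s, size s = #|T|, 3 <= size s & cycle e s].

End Graphs.

(* The Petersen graph: Kneser graph K(5,2) -- vertices are the 2-subsets
   of {0,...,4}, adjacent iff disjoint. *)
Definition petersen_vertex := {A : {set 'I_5} | #|A| == 2}.
Definition petersen_adj : rel petersen_vertex :=
  fun A B => [disjoint val A & val B].

Definition is_petersen (T : finType) (e : rel T) :=
  exists f : T -> petersen_vertex,
    bijective f /\ forall x y, e x y = petersen_adj (f x) (f y).

(* Main.v *)
Require Import Defs.
From mathcomp Require Import all_boot zify.
Set Implicit Arguments. Unset Strict Implicit. Unset Printing Implicit Defensive.

(** Let [c] be a longest cycle and [x] a vertex off [c]. The frame consists of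
    all vertices off [c] and of the successors on [c] of the neighbours of [x];
    Chvatal-Erdos arguments show that it is independent. Call a vertex outer if
    it has a neighbour in the frame, and inner otherwise. Since the graph is
    (K2 + k K1)-free, the inner vertices are independent and an outer vertex
    misses fewer than [k] vertices of any set of inner vertices; as alpha <=
    n/2, some two consecutive vertices of [c] are both outer (a run). Rerouting
    [c] through [x] gives, for many inner vertices [z], another longest cycle
    that avoids [z] and has the same runs, so that [z] is not adjacent to both
    ends of a run. The frame of [z] with respect to that cycle, applied to a
    run whose ends see [z] and another inner vertex [l], yields at least
    |frame| - k + 1 runs separating [z] from [l]. Comparing this number with
    the room left by the vertices that both ends of a run miss, the bound deg
    >= 3 (k - 1) / 2 leaves only the case of equality everywhere: [c] then
    splits into paths with three vertices, [k = 3], and the graph is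
    Petersen's. *)

(** * Cyclic sequences *)

Section CyclicSeq.
Variable T : eqType.
Implicit Types (s c P Q R : seq T) (a b g y z : T).

Lemma rot_next_cat i c s1 s2 a b :
  uniq c -> rot i c = s1 ++ a :: b :: s2 -> next c a = b.
Proof.
move=> Uc def_c; rewrite -(next_rot i Uc).
have U : uniq (rot i c) by rewrite rot_uniq.
rewrite {}def_c in U *; have := cycle_next U; case: s1 U => [|h s1] U /=.
  by case/andP => /eqP.
by rewrite rcons_path cat_path /= => /andP [] /andP [] _ /and3P [] _ /eqP.
Qed.

Lemma rot_prev_cons i c a s : uniq c -> rot i c = a :: s -> prev c a = last a s.
Proof.
move=> Uc def_c; rewrite -(prev_rot i Uc).
have U : uniq (rot i c) by rewrite rot_uniq.
rewrite {}def_c in U *; have := cycle_next U.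
rewrite /= rcons_path => /andP [_ /eqP nl].
by have := prev_next U (last a s); rewrite nl.
Qed.

Lemma rot_prev_cat i c s1 a P b s2 :
  uniq c -> rot i c = s1 ++ (a :: P) ++ b :: s2 -> prev c b = last a P.
Proof.
move=> Uc; rewrite (lastI a P) cat_rcons catA => /(rot_next_cat Uc) <-.
exact: prev_next.
Qed.

Lemma rot_perm i c s : rot i c = s -> perm_eq s c.
Proof. by move=> <-; rewrite perm_rot. Qed.

Lemma rot_split2 c a b : a \in c -> b \in c -> a != b ->
  exists P Q, rot (index a c) c = (a :: P) ++ b :: Q.
Proof.
move=> ac; rewrite -(mem_rot (index a c)) rot_index // inE eq_sym.
move: (_ ++ _) => s bs /negPf ab; rewrite ab /= in bs.
by case/splitPr: bs => P Q; exists P, Q.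
Qed.

Definition steps c a b := index b (rot (index a c) c).

Lemma index_rot m s a : uniq s -> a \in s -> m <= size s ->
  index a (rot m s) =
  if index a s < m then index a s + size s - m else index a s - m.
Proof.
move=> Us a_s le_ms; have in_tk := in_take m a_s.
have def_i := index_cat a (take m s) (drop m s).
rewrite cat_take_drop size_takel // in_tk in def_i.
have a_rot : a \in rot m s by rewrite mem_rot.
move: Us a_rot; rewrite -(rot_uniq m) /rot cat_uniq => /and3P [_ /hasPn disj _].
rewrite mem_cat index_cat size_drop in_tk.
case: ltnP in_tk def_i => [_ a_tk def_i|_ _ def_i] /=; last first.
  by rewrite orbF => ->; rewrite def_i addKn.
by have := disj a a_tk; rewrite /= => /negPf -> _; rewrite def_i; lia.
Qed.

Lemma stepsE c a b : uniq c -> a \in c -> b \in c ->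
  steps c a b = if index b c < index a c then index b c + size c - index a c
                else index b c - index a c.
Proof. by move=> Uc ac bc; rewrite /steps index_rot // index_size. Qed.

Lemma steps_lt_size c a b : b \in c -> steps c a b < size c.
Proof. by move=> bc; rewrite -(size_rot (index a c)) index_mem mem_rot. Qed.

Lemma steps_inj c a : {in c &, injective (steps c a)}.
Proof.
move=> b b' bc b'c; rewrite /steps => eq_ix.
by apply: (index_inj a) eq_ix; rewrite mem_rot.
Qed.

Lemma steps_eq0 c a b : a \in c -> (steps c a b == 0) = (a == b).
Proof. by move=> ac; rewrite /steps rot_index //=; case: (a == b). Qed.

Lemma steps_gt0 c a b : a \in c -> (0 < steps c a b) = (a != b).
Proof. by move=> ac; rewrite lt0n steps_eq0. Qed.

Lemma steps_refl c a : a \in c -> steps c a a = 0.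
Proof. by move=> ac; apply/eqP; rewrite steps_eq0. Qed.

Lemma steps_add c a b g : uniq c -> a \in c -> b \in c -> g \in c ->
  steps c a b + steps c b g =
  steps c a g + (if steps c a g < steps c a b then size c else 0).
Proof.
move=> Uc ac bc gc; rewrite !stepsE //.
by move: ac bc gc; rewrite -!index_mem; do !case: ifP; lia.
Qed.

Lemma steps_next c a : uniq c -> 1 < size c -> a \in c ->
  steps c a (next c a) = 1.
Proof.
move=> Uc; rewrite /steps => + ac; rewrite -(size_rot (index a c)).
have := rot_next_cat (i := index a c) Uc; have := rot_uniq (index a c) c.
rewrite Uc rot_index //.
case: (_ ++ _) => [//|b s] U /(_ [::] s a b erefl) -> _ /=.
by move: U; rewrite /= inE negb_or => /andP [/andP [/negPf -> _] _];
  rewrite eqxx.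
Qed.

Lemma steps_next_l c a b : uniq c -> 1 < size c -> a \in c -> b \in c ->
  a != b -> steps c a b = (steps c (next c a) b).+1.
Proof.
move=> Uc size_c ac bc ab.
have := steps_add Uc ac (etrans (mem_next c a) ac) bc.
rewrite steps_next // add1n ltnS leqn0 steps_eq0 // (negPf ab) addn0.
by move=> <-.
Qed.

Lemma steps_next_r c a b : uniq c -> 1 < size c -> a \in c -> b \in c ->
  next c b != a -> steps c a (next c b) = (steps c a b).+1.
Proof.
move=> Uc size_c ac bc nba; have nbc : next c b \in c by rewrite mem_next.
have := steps_add Uc ac bc nbc; rewrite steps_next // addn1.
have : 0 < steps c a (next c b) by rewrite steps_gt0 // eq_sym.
have := steps_lt_size a bc; move: (steps c a _) (steps c a _) (size c) => m n N.
by case: ifP; lia.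
Qed.

Lemma steps_prev_r c a b : uniq c -> 1 < size c -> a \in c -> b \in c ->
  a != b -> steps c a b = (steps c a (prev c b)).+1.
Proof.
move=> Uc size_c ac bc ab; rewrite -steps_next_r ?mem_prev ?next_prev //.
by rewrite eq_sym.
Qed.

Lemma next_next_neq c a : uniq c -> 2 < size c -> a \in c ->
  next c (next c a) != a.
Proof.
move=> Uc size_c ac; apply/eqP => nna.
have := @steps_add c a (next c a) (next c (next c a)) Uc ac.
rewrite !steps_next ?mem_next // ?(ltnW size_c) // nna ac => /(_ isT isT).
by rewrite steps_refl // add0n /= => size_eq2; rewrite -size_eq2 in size_c.
Qed.

Lemma steps_split3 c g a b : uniq c -> g \in c -> a \in c ->
  0 < steps c g b < steps c g a ->
  exists P Q R, rot (index g c) c = g :: P ++ (b :: Q) ++ a :: R.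
Proof.
rewrite -(rot_uniq (index g c)) -(mem_rot (index g c) c a) /steps => U gc.
rewrite rot_index // in U *; move: (_ ++ _) U => s.
rewrite cons_uniq => /andP [_ Us].
rewrite /= inE; case: (g == b) => //; case: (eqVneq g a) => //= _ a_s.
rewrite ltnS => lt_ba; case/splitPr: a_s Us lt_ba => s1 R Us lt_ba.
have b_s1 : b \in s1.
  move: Us; rewrite cat_uniq => /and3P [_ /norP [/negPf /= a_s1 _] _].
  move: lt_ba; rewrite !index_cat a_s1 /= eqxx addn0.
  by case: ifP => // _; rewrite ltnNge leq_addr.
by case/splitPr: b_s1 => P Q; exists P, Q, R; rewrite /= -catA.
Qed.

Lemma nth_rot_index z c a i : uniq c -> a \in c -> i < size c ->
  nth z (rot (index a c) c) i = iter i (next c) a.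
Proof.
move=> Uc ac; elim: i => [|i IHi] lt_ic; first by rewrite rot_index.
rewrite iterS -IHi ?(ltnW lt_ic) //; symmetry.
set s := rot (index a c) c.
apply: (@rot_next_cat (index a c) c (take i s) (drop i.+2 s)) => //.
by rewrite -!drop_nth ?size_rot ?cat_take_drop // ltnW.
Qed.

Definition cyc_adj c a b :=
  [&& a \in c, b \in c & (next c a == b) || (next c b == a)].

Lemma cyc_adj_rot i c a b : uniq c -> cyc_adj (rot i c) a b = cyc_adj c a b.
Proof. by move=> Uc; rewrite /cyc_adj !mem_rot !next_rot. Qed.

Lemma cyc_adj_rev c a b : uniq c -> cyc_adj (rev c) a b = cyc_adj c a b.
Proof.
move=> Uc; rewrite /cyc_adj !mem_rev !next_rev // orbC; congr [&& _, _ & _].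
by congr (_ || _); apply/eqP/eqP => <-; rewrite ?prev_next ?next_prev.
Qed.

Definition consec s a b := infix [:: a; b] s || infix [:: b; a] s.

Lemma consec_rev s a b : consec (rev s) a b = consec s a b.
Proof. by rewrite /consec orbC -!(infix_revLR _ s). Qed.

Lemma consec_cat_cons s1 s2 z a b : z != a -> z != b ->
  consec (s1 ++ z :: s2) a b = consec s1 a b || consec s2 a b.
Proof.
move=> za zb; suff inf u v : z != u -> z != v ->
    infix [:: u; v] (s1 ++ z :: s2) = infix [:: u; v] s1 || infix [:: u; v] s2.
  by rewrite /consec !inf // orbACA.
rewrite ![z == _]eq_sym => /negPf zu /negPf zv; elim: s1 => [|w [|w' s1] IHs].
- by rewrite /= zu.
- by rewrite /= zu zv !andbF.
- by rewrite cat_cons infix_consl IHs orbA /= !prefix0s.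
Qed.

Lemma infix_next c a b : uniq c -> infix [:: a; b] c -> next c a = b.
Proof.
by move=> Uc /infixP [s1 [s2 def_c]]; apply: (@rot_next_cat 0 c s1 s2);
  rewrite ?rot0.
Qed.

Lemma next_infix z s a b : uniq (z :: s) -> a \in z :: s -> z != b ->
  next (z :: s) a = b -> infix [:: a; b] (z :: s).
Proof.
move=> U a_s zb nab.
have [s1 [[|w s2] def_s]] : exists s1 s2, z :: s = s1 ++ a :: s2.
- by case/splitPr: a_s => s1 s2; exists s1, s2.
- have := rot_prev_cons U (rot0 _).
  rewrite -[last z s]/(last z (z :: s)) {2}def_s last_cat /=.
  by move=> pz; move: zb; rewrite -nab -pz next_prev ?eqxx.
- have := rot_next_cat U (etrans (rot0 _) def_s); rewrite nab => ->.
  by rewrite def_s -[a :: w :: s2]/([:: a; w] ++ s2) infix_infix.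
Qed.

Lemma cyc_adj_consec z s a b : uniq (z :: s) -> z != a -> z != b ->
  cyc_adj (z :: s) a b = consec s a b.
Proof.
move=> U za zb; have <- : consec (z :: s) a b = consec s a b.
  exact: (consec_cat_cons [::]).
rewrite /cyc_adj /consec; apply/idP/idP => [/and3P [ac bc]|adj].
  by case/orP => /eqP /next_infix -> //; rewrite orbT.
have sub u v : infix [:: u; v] (z :: s) -> (u \in z :: s) && (v \in z :: s).
  by move/mem_infix => sub; rewrite !sub ?inE ?eqxx ?orbT.
have /andP [-> ->] : (a \in z :: s) && (b \in z :: s).
  by case/orP: adj => /sub // /andP [-> ->].
by case/orP: adj => /(infix_next U) ->; rewrite eqxx ?orbT.
Qed.

End CyclicSeq.

Lemma leq_card_three_ordered (T : finType) (pos : T -> nat)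
  (S A B C : {set T}) :
  {in S &, injective pos} -> A :|: B :|: C \subset S ->
  {in A & B, forall a b, pos a < pos b} -> B != set0 ->
  {in B & C, forall b c, pos b <= pos c} -> #|A| + #|B| + #|C| <= #|S|.+1.
Proof.
move=> pos_inj sub ltAB /set0Pn [b0 b0B] leBC.
have AB0 : A :&: B = set0.
  apply/setP => z; rewrite in_set0 in_setI; apply/negP => /andP [zA zB].
  by have := ltAB _ _ zA zB; rewrite ltnn.
have AC0 : A :&: C = set0.
  apply/setP => z; rewrite in_set0 in_setI; apply/negP => /andP [zA zC].
  by have := ltAB _ _ zA b0B; rewrite ltnNge leBC.
have BC1 : #|B :&: C| <= 1.
  apply/card_le1_eqP => y z /setIP [yB yC] /setIP [zB zC]; apply: pos_inj.
  - by apply: (subsetP sub); rewrite !in_setU ?yB ?zB orbT.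
  - by apply: (subsetP sub); rewrite !in_setU ?yB ?zB orbT.
  - by apply/eqP; rewrite eqn_leq !leBC.
have := subset_leq_card sub; have := subset_leq_card (subsetIl B C).
rewrite !cardsU setIUl AC0 AB0 set0U cards0; move: BC1; clear.
by do !move: (card _) => ?; lia.
Qed.

(** * The Petersen graph *)

Section Petersen.

Lemma card_pair (i j : 'I_5) : i != j -> #|[set i; j]| == 2.
Proof. by move=> ij; rewrite cards2 ij. Qed.

Definition pair_vertex (i j : 'I_5) (ij : i != j) : petersen_vertex :=
  exist _ [set i; j] (card_pair ij).

Lemma pair_vertex_adj (i j i' j' : 'I_5) (ij : i != j) (ij' : i' != j') :
  petersen_adj (pair_vertex ij) (pair_vertex ij') =
  [&& val i != val i', val i != val j', val j != val i' & val j != val j'].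
Proof.
rewrite /petersen_adj /= -setI_eq0 setIUl setU_eq0 !setI_eq0 !disjoints1 !inE.
by rewrite !negb_or -!andbA !val_eqE.
Qed.

Lemma petersen_adj_sym : symmetric petersen_adj.
Proof. by move=> A B; apply: disjoint_sym. Qed.

Lemma petersen_adj_irr : irreflexive petersen_adj.
Proof.
move=> A; rewrite /petersen_adj -setI_eq0 setIid -cards_eq0.
by rewrite (eqP (valP A)).
Qed.

Lemma card_petersen_vertex : #|{: petersen_vertex}| = 10.
Proof.
rewrite card_sig; have := card_draws 'I_5 2.
rewrite card_ord cardsE => card_pairs.
exact: card_pairs.
Qed.

(* The last nine pairs form a cycle; the first one is adjacent to every third
   vertex of it. *)
Definition petersen_list : seq petersen_vertex :=
  let o m (h : m < 5) := Ordinal h in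
  let p i j (hi : i < 5) (hj : j < 5) (h : o i hi != o j hj) := pair_vertex h in
  [:: p 0 1 isT isT isT;
      p 0 2 isT isT isT; p 1 3 isT isT isT; p 2 4 isT isT isT;
      p 0 3 isT isT isT; p 1 4 isT isT isT; p 2 3 isT isT isT;
      p 0 4 isT isT isT; p 1 2 isT isT isT; p 3 4 isT isT isT].

Definition petersen_nth := nth (@pair_vertex ord0 ord_max isT) petersen_list.

Lemma petersen_list_uniq : uniq petersen_list.
Proof.
pose o m (h : m < 5) := Ordinal h.
apply: (@map_uniq _ _ (fun A : petersen_vertex =>
  [:: o 0 isT \in val A; o 1 isT \in val A; o 2 isT \in val A;
      o 3 isT \in val A; o 4 isT \in val A])).
by rewrite /= !in_set2.
Qed.

Lemma is_petersen_of_enum (T : finType) (e : rel T) x0 (s : seq T) :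
  symmetric e -> irreflexive e -> uniq s -> size s = 10 -> #|T| = 10 ->
  (forall i j, i < j -> j < 10 ->
     e (nth x0 s i) (nth x0 s j) =
     petersen_adj (petersen_nth i) (petersen_nth j)) ->
  is_petersen e.
Proof.
move=> esym eirr Us size_s card_T adj_lt.
have mem_s y : y \in s.
  have : s =i T
    by apply/subset_cardP; rewrite ?subset_predT // card_T (card_uniqP Us).
  by move=> ->.
have lt_index y : index y s < 10 by rewrite -size_s index_mem.
have adj i j : i < 10 -> j < 10 ->
    e (nth x0 s i) (nth x0 s j) =
    petersen_adj (petersen_nth i) (petersen_nth j).
  move=> i10 j10; case: (ltngtP i j) => [ij|ji|->].
  - exact: adj_lt.
  - by rewrite esym petersen_adj_sym adj_lt.
  - by rewrite eirr petersen_adj_irr.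
exists (fun y => petersen_nth (index y s)); split; last first.
  by move=> y z; rewrite -adj // !nth_index.
apply: inj_card_bij; last by rewrite card_petersen_vertex card_T.
move=> y z /eqP.
rewrite /petersen_nth nth_uniq ?petersen_list_uniq ?lt_index // => /eqP.
by apply: (index_inj y).
Qed.

End Petersen.

(* Abstracting the atoms keeps [lia] from traversing the terms inside. *)
Ltac card_lia :=
  clear; repeat match goal with
  | |- context [card ?A] => move: (card A) => ?
  end; lia.

Ltac perm_count_from perm_c :=
  let q := fresh in apply/permP => q; have := permP perm_c q; clear;
  rewrite /= ?(count_cat, count_rev) /= ?(count_cat, count_rev) /=;
  repeat match goal with
  | |- context [count ?a ?s] => move: (count a s) => ?
  | |- context [nat_of_bool ?b] => move: (nat_of_bool b) => ?
  end; lia.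

Section Graph.
Variables (T : finType) (e : rel T).
Hypotheses (esym : symmetric e) (eirr : irreflexive e).
Implicit Types (c p P Q A : seq T) (I H S : {set T}) (a b g h s u v x y z : T).

Lemma independentP I : reflect {in I &, forall y z, ~~ e y z} (independent e I).
Proof.
apply: (iffP forall_inP) => [ind y z /ind /forall_inP|ind y yI]; first exact.
by apply/forall_inP => z; apply: ind.
Qed.

Lemma independent_leq_alpha I : independent e I -> #|I| <= alpha e.
Proof. exact: (@leq_bigmax_cond _ _ (fun S : {set T} => #|S|)). Qed.

Lemma min_degree_leq v : min_degree e <= deg e v.
Proof. by apply/bigmax_leqP => d /forallP. Qed.

Definition boundary H := [set u in ~: H | [exists h in H, e h u]].

Lemma boundaryP H u :
  reflect (u \notin H /\ exists2 h, h \in H & e h u) (u \in boundary H).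
Proof. by rewrite !inE; apply: (iffP andP) => -[uH /exists_inP]. Qed.

Lemma k_connected_boundary k H a b : k_connected k e ->
  a \in H -> b \notin H :|: boundary H -> k <= #|boundary H|.
Proof.
move=> [_ conn] aH; rewrite in_setU => /norP [bH bB].
rewrite leqNgt; apply/negP => /conn /(_ a b) conn_ab.
have aB : a \notin boundary H by apply/boundaryP => -[/negP].
pose off_boundary :=
  [rel u v | [&& e u v, u \notin boundary H & v \notin boundary H]].
have closedH : closed off_boundary (mem H).
  apply: intro_closed => [|u v /and3P [uv _ vB] uH].
    apply: sym_connect_sym => u v.
    by rewrite /= esym; congr andb; rewrite andbC.
  by apply: contraR vB => vH; apply/boundaryP; split; last exists u.
by have := closed_connect closedH (conn_ab aB bB); rewrite aH (negPf bH).
Qed.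

Lemma k_connected_deg k v : k_connected k e -> k <= deg e v.
Proof.
move=> conn; have def_nbrs : boundary [set v] = [set u | e v u].
  apply/setP => u; rewrite [RHS]inE; apply/boundaryP/idP => [[_ [h]]|vu].
    by rewrite inE => /eqP ->.
  split; last by exists v; rewrite ?inE.
  by apply: contraTN vu; rewrite inE => /eqP ->; rewrite eirr.
have [kT _] := conn; rewrite /deg -def_nbrs.
have [b bN|cover] := pickP [pred b | b \notin [set v] :|: boundary [set v]].
  exact: k_connected_boundary conn (set11 v) bN.
have def_T : [set: T] = v |: boundary [set v].
  by apply/setP => b; rewrite in_setT; have := cover b => /= /negbFE ->.
by move: kT; rewrite -cardsT def_T cardsU1; case: (_ \notin _) => /=; lia.
Qed.

(** * Longest cycles and exchanges *)

Lemma exists_longest_seq (P : pred (seq T)) (s0 : seq T) : uniq s0 -> P s0 ->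
  exists s : seq T,
    [/\ uniq s, P s & forall s' : seq T, uniq s' -> P s' -> size s' <= size s].
Proof.
move=> U0 P0; pose has_size n := [exists t : n.-tuple T, uniq t && P t].
have sizeP (s : seq T) : uniq s -> P s -> has_size (size s).
  by move=> Us Ps; apply/existsP; exists (in_tuple s); rewrite Us.
have bounded n : has_size n -> n <= #|T|.
  case/existsP => t /andP [Ut _].
  by rewrite -(size_tuple t) -(card_uniqP Ut) max_card.
have [m /existsP [t /andP [Ut Pt]] max_m] :=
  ex_maxnP (ex_intro has_size _ (sizeP s0 U0 P0)) bounded.
by exists t; split=> // s' Us' Ps'; rewrite size_tuple max_m ?sizeP.
Qed.

(* The first vertex of a longest path has all its neighbours on the path. *)
Lemma exists_cycle : 0 < #|T| -> (forall v, 1 < deg e v) ->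
  exists c, [/\ uniq c, cycle e c & 2 < size c].
Proof.
case/card_gt0P => v0 _ deg_gt1.
have [[|a s] [Us path_s max_s]] :=
  @exists_longest_seq (sorted e) [:: v0] isT isT.
  by have := max_s [:: v0] isT isT.
have nbr_s b : e a b -> b \in s.
  move=> ab; apply: contraT => bs.
  have ba : b != a by apply: contraTneq ab => ->; rewrite eirr.
  have := max_s (b :: a :: s); rewrite ltnn; apply; last by rewrite /= esym ab.
  by rewrite cons_uniq inE negb_or ba bs.
have [b] : exists b, b \in [set w | e a w] :\ head a s.
  apply/card_gt0P; have := deg_gt1 a; rewrite /deg (cardsD1 (head a s)).
  by case: (_ \in _); lia.
rewrite !inE => /andP [b_head ab].
case/splitPr: (nbr_s b ab) Us path_s b_head => -[|h s1] s2 Us path_s /=.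
  by rewrite eqxx.
move=> _; exists (a :: rcons (h :: s1) b); split; last by rewrite /= size_rcons.
  have : uniq ((a :: rcons (h :: s1) b) ++ s2) by rewrite /= cat_rcons.
  by rewrite cat_uniq => /andP [].
move: path_s; rewrite /= -cat_rcons cat_path => /and3P [-> path_b _].
by rewrite rcons_path path_b last_rcons esym ab.
Qed.

Definition longest c :=
  [/\ uniq c, cycle e c, 2 < size c &
      forall c', uniq c' -> cycle e c' -> size c' <= size c].

Lemma exists_longest : 0 < #|T| -> (forall v, 1 < deg e v) ->
  exists c, longest c.
Proof.
move=> T0 deg_gt1; have [c0 [U0 C0 size_c0]] := exists_cycle T0 deg_gt1.
have [c [Uc Cc max_c]] := exists_longest_seq U0 C0.
by exists c; split => //; apply: leq_trans (max_c _ U0 C0).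
Qed.

Lemma longest_rot i c : longest c -> longest (rot i c).
Proof. by case=> *; split; rewrite ?rot_uniq ?rot_cycle ?size_rot. Qed.

Lemma longest_rev c : longest c -> longest (rev c).
Proof.
case=> Uc Cc *; split; rewrite ?rev_uniq ?size_rev //.
by rewrite rev_cycle (eq_cycle (e' := e)) // => u v; rewrite esym.
Qed.

Lemma longest_eq_size c c' :
  longest c -> uniq c' -> cycle e c' -> size c' = size c -> longest c'.
Proof. by case=> _ _ size_c max_c U C eq_size; split; rewrite ?eq_size. Qed.

Lemma longest_no_extension c c' h p : longest c -> uniq ((h :: p) ++ c) ->
  perm_eq c' ((h :: p) ++ c) -> ~~ cycle e c'.
Proof.
case=> _ _ _ max_c U perm_c'; apply/negP => /max_c.
by rewrite (perm_uniq perm_c') (perm_size perm_c') size_cat /= => /(_ U); lia.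
Qed.

Lemma cycle_cat_cons a P b Q : cycle e ((a :: P) ++ b :: Q) =
  [&& path e a P, e (last a P) b, path e b Q & e (last b Q) a].
Proof. by rewrite /= rcons_path cat_path last_cat /= -!andbA. Qed.

Lemma path_rev_cons y b Q :
  path e y (rev (b :: Q)) = e y (last b Q) && path e b Q.
Proof.
rewrite lastI rev_rcons /= rev_path; congr (_ && _).
by apply: eq_path => u v; rewrite esym.
Qed.

Lemma last_rev_cons y b Q : last y (rev (b :: Q)) = b.
Proof. by rewrite rev_cons last_rcons. Qed.

(* The rerouting behind the exchange arguments: the arc [b Q] of a cycle is
   reversed and rejoined to the arc [g P] through [h p] and [A]. *)
Lemma cycle_reroute h p b Q A g P :
  path e h p -> path e b Q -> path e g P -> path e b (rcons A g) ->
  e (last h p) (last b Q) -> e (last g P) h ->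
  cycle e ((h :: p) ++ rev (b :: Q) ++ A ++ g :: P).
Proof.
move=> hp bQ gP; rewrite rcons_path => /andP [bA Ag] pQ Ph.
rewrite /= rcons_path cat_path hp cat_path path_rev_cons pQ bQ last_rev_cons.
by rewrite cat_path bA /= Ag gP !last_cat /= Ph.
Qed.

Definition bridge c u v :=
  exists h p, [/\ uniq ((h :: p) ++ c), path e h p, e u h & e (last h p) v].

Lemma bridge1 c x u v : uniq c -> x \notin c -> e x u -> e x v -> bridge c u v.
Proof.
by move=> Uc xc xu xv; exists x, [::]; split; rewrite //= ?xc // esym.
Qed.

Lemma no_bridge_next c u : longest c -> u \in c -> ~ bridge c u (next c u).
Proof.
move=> L uc [h [p [U hp uh pu]]]; have [Uc Cc _ _] := L.
have [i P def_c] : rot_to_spec c (next c u) by apply: rot_to; rewrite mem_next.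
have := longest_no_extension (c' := (h :: p) ++ rot i c) L U.
rewrite perm_cat2l perm_rot def_c cycle_cat_cons hp pu perm_refl => /(_ isT).
move: Cc; rewrite -(rot_cycle i) def_c /= rcons_path => /andP [-> _].
by rewrite -(rot_prev_cons Uc def_c) prev_next // uh.
Qed.

Lemma no_parallel_bridges c u v h p A : longest c -> u \in c -> v \in c ->
  u != v ->
  uniq ((h :: p ++ A) ++ c) -> path e h p -> e u h -> e (last h p) v ->
  ~~ path e (next c u) (rcons A (next c v)).
Proof.
move=> L uc vc uv U hp uh pv; have [Uc Cc _ _] := L.
have ne : next c v != next c u by rewrite eq_sym (can_eq (prev_next Uc)).
have [P [Q def_c]] : exists P Q,
    rot (index (next c v) c) c = (next c v :: P) ++ next c u :: Q.
  by apply: rot_split2; rewrite ?mem_next.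
pose c' := (h :: p) ++ rev (next c u :: Q) ++ A ++ next c v :: P.
have perm_c' : perm_eq c' ((h :: p ++ A) ++ c)
  by perm_count_from (rot_perm def_c).
apply: contra (longest_no_extension L U perm_c') => uAv.
move: Cc; rewrite -(rot_cycle (index (next c v) c)) def_c cycle_cat_cons.
case/and4P => vP _ uQ _; apply: cycle_reroute => //.
- by have := rot_prev_cons Uc def_c; rewrite prev_next // last_cat /= => <-.
- by rewrite -(rot_prev_cat (s1 := [::]) Uc def_c) prev_next.
Qed.

Lemma bridge_next_nonadj c u v : longest c -> u \in c -> v \in c ->
  bridge c u v -> ~~ e (next c u) (next c v).
Proof.
move=> L uc vc [h [p [U hp uh pv]]]; have [<-|uv] := eqVneq u v.
  by rewrite eirr.
have := @no_parallel_bridges c u v h p [::] L uc vc uv.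
by rewrite cats0 /= andbT; apply.
Qed.

Lemma next_pair_nonadj c x y u v : longest c -> x \notin c -> y \notin c ->
  x != y -> u \in c -> v \in c -> u != v -> e x u -> e x v ->
  e y (next c u) -> ~~ e y (next c v).
Proof.
move=> L xc yc xy uc vc uv xu xv; rewrite [e y (next c u)]esym => uy.
have := @no_parallel_bridges c u v x [::] [:: y] L uc vc uv.
by rewrite /= uy andbT /= inE negb_or xy xc yc esym; apply => //; case: L.
Qed.

Section K2kK1Free.
Variable k : nat.
Hypothesis free : K2_kK1_free k e.

Lemma common_nonnbrs_card o y I : e o y -> independent e I ->
  {in I, forall z, ~~ e o z && ~~ e y z} -> #|I| < k.
Proof.
move=> oy /independentP indI nonadj; rewrite ltnNge.
apply/negP => /card_geqP [s [Us size_s sI]].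
apply: free; exists o, y, [set z in s]; split => //.
- rewrite !inE; apply/andP.
  by split; apply/negP => /sI /nonadj; rewrite ?oy // esym oy andbF.
- by rewrite cardsE (card_uniqP Us).
- by apply/independentP => u v; rewrite !inE => /sI uI /sI; apply: indI.
- by move=> w; rewrite inE => /sI /nonadj.
Qed.

Lemma nonnbrs_card o y I : independent e I -> y \in I -> e o y ->
  #|[set z in I | ~~ e o z]| < k.
Proof.
move=> /independentP indI yI oy; apply: (common_nonnbrs_card oy).
  by apply/independentP => u v; rewrite !inE => /andP [uI _] /andP [vI _];
    apply: indI.
by move=> z; rewrite inE => /andP [zI ->]; apply: indI.
Qed.

Hypothesis conn : k_connected k e.

Definition off c := [set y | y \notin c].

Definition off_component c a :=
  [set y | connect [rel u v | [&& e u v, u \notin c & v \notin c]] a y].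

Lemma off_component_off c a y : a \notin c -> y \in off_component c a ->
  y \notin c.
Proof.
move=> ac; rewrite inE => /connectP [p path_p ->].
elim/last_ind: p path_p => //= p u _.
by rewrite rcons_path last_rcons => /andP [_ /and3P []].
Qed.

Lemma off_component_bridge c a h h' u v : uniq c -> a \notin c ->
  h \in off_component c a -> h' \in off_component c a -> e u h -> e h' v ->
    bridge c u v.
Proof.
move=> Uc ac hH h'H uh h'v; have hc := off_component_off ac hH.
have offsym : connect_sym [rel u v | [&& e u v, u \notin c & v \notin c]].
  by apply: sym_connect_sym => y z /=; rewrite esym; congr andb; rewrite andbC.
move: hH h'H; rewrite !inE offsym => ha ah'.
case/connectP: (connect_trans ha ah') h'v => p0 path_p0 ->.
case/shortenP: path_p0 => p path_p Up _ {p0} pv; exists h, p; split => //;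
  last first.
  by apply: sub_path path_p => y z /and3P [].
rewrite cat_uniq Up Uc /= andbT; apply/hasPn => y yc; apply: contraL yc.
rewrite inE => /predU1P [->|]; first exact: hc.
elim: p h path_p {Up pv hc ha uh} => //= w p IHp h.
case/andP=> /and3P [_ _ wc] path_p.
by rewrite inE => /predU1P [-> //|]; apply: IHp path_p.
Qed.

Lemma boundary_off_component c a : a \notin c ->
  {subset boundary (off_component c a) <= c}.
Proof.
move=> ac u /boundaryP [uH [h hH hu]]; apply: contraR uH => uc.
have hc := off_component_off ac hH; rewrite !inE in hH *.
by apply: connect_trans hH _; apply: connect1; rewrite /= hu hc uc.
Qed.

(* Chvatal-Erdos: the successors of the attachments of a component off [c] are
   independent, and none of them has a neighbour in the component. *)
Lemma off_independent c : longest c -> independent e (off c).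
Proof.
move=> L; have [Uc _ size_c _] := L.
apply/independentP => a b; rewrite !inE => ac bc; apply/negP => ab.
set H := off_component c a; set A := boundary H.
have aH : a \in H by rewrite inE connect0.
have bH : b \in H by rewrite inE connect1 //= ab ac bc.
have Ac : {subset A <= c} := boundary_off_component ac.
have bridgeA u v : u \in A -> v \in A -> bridge c u v.
  move=> /boundaryP [_ [h hH hu]] /boundaryP [_ [h' h'H h'v]].
  by apply: (off_component_bridge Uc ac hH h'H); rewrite // esym.
have nextA u : u \in A -> next c u \notin A.
  by move=> uA; apply/negP => /(bridgeA _ _ uA); apply/no_bridge_next/Ac.
have card_A : k <= #|A|.
  have [y yc yA] : exists2 y, y \in c & y \notin A.
    have [y yc] : exists y, y \in c
      by case: (c) size_c => // y s; exists y; apply: mem_head.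
    by case: (boolP (y \in A)) => [/nextA|yA]; [exists (next c y)|exists y];
      rewrite ?mem_next.
  apply: (k_connected_boundary conn aH (b := y));
    rewrite in_setU negb_or yA andbT.
  by apply: contraL yc => /(off_component_off ac).
have ind : independent e [set next c u | u in A].
  apply/independentP => _ _ /imsetP [u uA ->] /imsetP [v vA ->].
  by apply: bridge_next_nonadj => //; [apply: Ac|apply: Ac|apply: bridgeA].
suff /(common_nonnbrs_card ab ind) :
  {in [set next c u | u in A], forall z, ~~ e a z && ~~ e b z}.
  by rewrite card_imset ?ltnNge ?card_A //; apply: can_inj (prev_next Uc).
move=> _ /imsetP [u uA ->]; rewrite -negb_or; apply: contra (nextA u uA) => adj.
apply/boundaryP; split.
  by apply: contraL (Ac _ uA) => /(off_component_off ac); rewrite mem_next.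
by case/orP: adj; [exists a|exists b].
Qed.

Lemma off_nonadj c y z : longest c -> y \notin c -> z \notin c -> ~~ e y z.
Proof.
by move=> L yc zc; apply: (independentP _ (off_independent L)); rewrite inE.
Qed.

(** * The frame of a longest cycle *)

Definition succs c x := [set y in c | e x (prev c y)].
Definition frame c x := off c :|: succs c x.

Lemma in_frame c x y : (y \in frame c x) = (y \notin c) || e x (prev c y).
Proof. by rewrite !inE; case: (y \in c). Qed.

Section Frame.
Variables (c : seq T) (x : T).
Hypotheses (L : longest c) (xc : x \notin c).
Let Uc : uniq c. Proof. by case: L. Qed.

Lemma nbr_mem u : e x u -> u \in c.
Proof. by apply: contraTT; apply: off_nonadj. Qed.

Lemma next_nbr u : e x u -> next c u \in succs c x.
Proof. by move=> xu; rewrite inE mem_next nbr_mem // prev_next. Qed.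

Lemma succsP s :
  reflect (exists u, [/\ u \in c, e x u & s = next c u]) (s \in succs c x).
Proof.
apply: (iffP idP) => [|[u [_ xu ->]]]; last exact: next_nbr.
by rewrite inE => /andP [sc xs]; exists (prev c s); rewrite mem_prev next_prev.
Qed.

Lemma card_succs : #|succs c x| = deg e x.
Proof.
rewrite /deg -[RHS](card_imset _ (can_inj (prev_next Uc))); apply: eq_card => s.
apply/succsP/imsetP => [[u [uc xu ->]]|[u]]; first by exists u; rewrite ?inE.
by rewrite inE => xu ->; exists u; rewrite nbr_mem.
Qed.

Lemma card_frame : #|frame c x| = #|off c| + deg e x.
Proof.
rewrite -card_succs /frame cardsU disjoint_setI0 ?cards0 ?subn0 //.
by apply/pred0P => y; rewrite /= !inE; case: (y \in c).
Qed.

Lemma card_off_gt0 : 0 < #|off c|.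
Proof. by apply/card_gt0P; exists x; rewrite inE. Qed.

Lemma k_lt_frame : k < #|frame c x|.
Proof.
by rewrite card_frame; have := k_connected_deg x conn;
  have := card_off_gt0; card_lia.
Qed.

Lemma x_succs_nonadj s : s \in succs c x -> ~~ e x s.
Proof.
case/succsP => u [uc xu ->]; apply/negP => xs.
by apply: (no_bridge_next L uc); apply: bridge1 xu xs.
Qed.

Lemma x_succs_independent : independent e (x |: succs c x).
Proof.
apply/independentP => y z; rewrite !in_setU1.
case/predU1P => [->|yS] /predU1P [->|zS]; rewrite ?eirr ?x_succs_nonadj //.
  by rewrite esym x_succs_nonadj.
case/succsP: yS zS => u [uc xu ->] /succsP [v [vc xv ->]].
by apply: bridge_next_nonadj => //; apply: bridge1 xu xv.
Qed.

Lemma off_succs_nonadj y s : y \notin c -> s \in succs c x -> ~~ e y s.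
Proof.
move=> yc sS; have [<-|xy] := eqVneq x y; first exact: x_succs_nonadj.
apply/negP => ys; have := nonnbrs_card x_succs_independent (setU1r x sS) ys.
apply/negP; rewrite -leqNgt; apply: leq_trans (k_connected_deg x conn) _.
have -> : deg e x = #|x |: succs c x :\ s|.
  by rewrite -card_succs (cardsD1 s (succs c x)) sS cardsU1 !inE
    (negPf xc) andbF.
apply: subset_leq_card; apply/subsetP => z;
  rewrite in_setU1 in_setD1 inE in_setU1.
case/predU1P => [->|/andP [zs zS]].
  by rewrite eqxx (off_nonadj L).
rewrite zS orbT /=.
move: sS zS ys zs => /succsP [u [uc xu ->]] /succsP [v [vc xv ->]] ynu.
rewrite (can_eq (prev_next Uc)) eq_sym => uv.
exact: next_pair_nonadj xu xv ynu.
Qed.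

Lemma frame_independent : independent e (frame c x).
Proof.
apply/independentP => y z; rewrite !in_setU ![_ \in off c]inE.
case/orP => [yc|yS] /orP [zc|zS].
- exact: (off_nonadj L).
- exact: off_succs_nonadj.
- by rewrite esym off_succs_nonadj.
- by apply: (independentP _ x_succs_independent); rewrite in_setU1 ?yS ?zS orbT.
Qed.

Lemma x_frame : x \in frame c x.
Proof. by rewrite in_frame xc. Qed.

Lemma succs_frame : {subset succs c x <= frame c x}.
Proof. by move=> y yS; rewrite in_setU yS orbT. Qed.

Lemma succs_mem : {subset succs c x <= c}.
Proof. by move=> y; rewrite inE => /andP []. Qed.

End Frame.

Hypothesis deg_bound : forall v, 3 * (k - 1) <= 2 * deg e v.

Lemma frame_lower_bound c x : longest c -> x \notin c ->
  3 * (k - 1) + 2 <= 2 * #|frame c x|.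
Proof.
move=> L xc; rewrite card_frame //; have := deg_bound x.
have := card_off_gt0 xc.
by card_lia.
Qed.

Section LongestCycle.
Variables (c : seq T) (x : T).
Hypotheses (L : longest c) (xc : x \notin c).
Let Uc : uniq c. Proof. by case: L. Qed.
Let Cc : cycle e c. Proof. by case: L. Qed.
Let size_c : 2 < size c. Proof. by case: L. Qed.

Definition outer := [set o | [exists y in frame c x, e o y]].
Definition inner := ~: outer.

Lemma outerP o : reflect (exists2 y, y \in frame c x & e o y) (o \in outer).
Proof. by rewrite inE; apply: exists_inP. Qed.

Lemma innerP z : reflect {in frame c x, forall y, ~~ e z y} (z \in inner).
Proof.
rewrite in_setC; apply: (iffP idP) => [zO y yF|nonadj].
  by apply: contra zO => zy; apply/outerP; exists y.
by apply/outerP => -[y /nonadj /negP].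
Qed.

Lemma neq_inner_outer z o : z \in inner -> o \in outer -> z != o.
Proof. by rewrite in_setC => zI oO; apply: contraNneq zI => ->. Qed.

Lemma frame_inner : {subset frame c x <= inner}.
Proof.
move=> y yF; apply/innerP => z.
exact: (independentP _ (frame_independent L xc)).
Qed.

Lemma x_inner : x \in inner.
Proof. exact: frame_inner (x_frame xc). Qed.

Lemma succs_inner : {subset succs c x <= inner}.
Proof. by move=> y /succs_frame /frame_inner. Qed.

Lemma inner_independent : independent e inner.
Proof.
apply/independentP => y z /innerP y_nonadj /innerP z_nonadj; apply/negP => yz.
have /(common_nonnbrs_card yz (frame_independent L xc)) :
    {in frame c x, forall t, ~~ e y t && ~~ e z t}.
  by move=> t tF; rewrite y_nonadj ?z_nonadj.
by rewrite ltnNge ltnW // k_lt_frame.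
Qed.

Lemma inner_nonadj y z : y \in inner -> z \in inner -> ~~ e y z.
Proof. exact: (independentP _ inner_independent). Qed.

Lemma inner_nbr_outer z o : z \in inner -> e z o -> o \in outer.
Proof.
by move=> zI; apply: contraTT => oO; apply: inner_nonadj; rewrite // in_setC.
Qed.

Lemma outer_mem : {subset outer <= c}.
Proof.
move=> o; apply: contraTT => oc; rewrite -in_setC.
by apply: frame_inner; rewrite in_frame oc.
Qed.

Lemma outer_nonnbrs_card I o : {subset I <= inner} -> o \in outer ->
  #|[set z in I | ~~ e o z]| < k.
Proof.
move=> sub_inner /outerP [y yF oy]; apply: (common_nonnbrs_card oy).
  apply/independentP => u v; rewrite !inE -!(rwP andP) => -[uI _] [vI _].
  by apply: inner_nonadj; apply: sub_inner.
move=> z; rewrite inE => /andP [zI ->].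
by apply: inner_nonadj; [apply: frame_inner|apply: sub_inner].
Qed.

Lemma outer_nbr_in I o : {subset I <= inner} -> o \in outer -> k <= #|I| ->
  exists2 z, z \in I & e o z.
Proof.
move=> sub_inner oO card_I; apply/exists_inP; apply: contraT.
rewrite negb_exists_in => /forall_inP nonadj.
have := outer_nonnbrs_card sub_inner oO.
rewrite [X in #|pred_of_set X|](_ : _ = I) ?ltnNge ?card_I //.
by apply/setP => z; rewrite inE; case: (boolP (z \in I)) => // /nonadj.
Qed.

Lemma outer_succ_nbr o : o \in outer -> exists2 a, a \in succs c x & e o a.
Proof.
move=> oO; apply: outer_nbr_in => //; first exact: succs_inner.
by rewrite card_succs // k_connected_deg.
Qed.

Lemma next_inner_outer z : z \in c -> z \in inner -> next c z \in outer.
Proof. by move=> zc zI; apply: (inner_nbr_outer zI); apply: next_cycle. Qed.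

Lemma prev_inner_outer z : z \in c -> z \in inner -> prev c z \in outer.
Proof.
by move=> zc zI; apply: (inner_nbr_outer zI); rewrite esym; apply: prev_cycle.
Qed.

Lemma next_outer_nonadj f : next c f \in outer -> ~~ e x f.
Proof.
apply: contraTN => /(next_nbr L xc) /succs_inner.
by rewrite in_setC.
Qed.

Lemma next_succ_nbr a : a \in succs c x ->
  exists b, [/\ b \in succs c x, b != a & e (next c a) b].
Proof.
move=> aS; have ac := succs_mem aS; set o := next c a.
have oO : o \in outer by apply: next_inner_outer => //; apply: succs_inner.
have [||b] := @outer_nbr_in (x |: succs c x :\ a) o _ oO.
- by move=> z /setU1P [->|/setD1P [_ /succs_inner]] //; apply: x_inner.
- have := k_connected_deg x conn; rewrite -(card_succs L xc) (cardsD1 a) aS.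
  by rewrite cardsU1 !inE (negPf xc) andbF.
rewrite in_setU1 in_setD1 => /predU1P [->|/andP [ba bS]] ob; last by exists b.
exists (next c o); split; first by apply: next_nbr; rewrite // esym.
- exact: next_next_neq.
- by apply: next_cycle => //; apply: outer_mem.
Qed.

(** * Detours and runs *)

Definition detour c' z :=
  [/\ longest c', z \notin c', {subset outer <= c'} &
      {in outer &, cyc_adj c =2 cyc_adj c'}].

Definition avoidable z := exists c', detour c' z.

Lemma off_avoidable y : y \notin c -> avoidable y.
Proof. by move=> yc; exists c; split => // o /outer_mem. Qed.

Lemma detour_rev c' z : detour c' z -> detour (rev c') z.
Proof.
case=> L' zc' Oc' adj; have Uc' : uniq c' by case: L'.
split; rewrite ?mem_rev //; first exact: longest_rev.
- by move=> o /Oc'; rewrite mem_rev.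
- by move=> a b aO bO; rewrite cyc_adj_rev // adj.
Qed.

Lemma reroute_cycle i z g P b Q A A' :
  rot i c = z :: (g :: P) ++ (b :: Q) ++ A ->
  b \in succs c x -> head z A \in succs c x -> path e b (rcons A' g) ->
  cycle e (x :: rev (b :: Q) ++ A' ++ g :: P).
Proof.
move=> def_c bS aS bA'g; have := Cc; rewrite -(rot_cycle i) def_c.
rewrite /= rcons_path cat_path /= cat_path.
case/and3P => _ /and4P [gP _ bQ _] _; apply: (@cycle_reroute x [::]) => //=.
- case: A def_c aS => [|a A] def_c /=; rewrite inE => /andP [_].
    by rewrite (rot_prev_cons Uc def_c) cats0 last_cat.
  by rewrite (rot_prev_cat (s1 := z :: g :: P) Uc def_c).
- move: bS; rewrite inE => /andP [_].
  by rewrite (rot_prev_cat (s1 := [:: z]) Uc def_c) esym.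
Qed.

Lemma detour_reroute i z g P b Q A :
  rot i c = z :: (g :: P) ++ (b :: Q) ++ A ->
  z \in inner -> b \in succs c x -> head z A \in succs c x ->
  path e b (rcons (rev A) g) -> detour (x :: rev (b :: Q) ++ rev A ++ g :: P) z.
Proof.
move=> def_c zI bS aS bAg; set c' := (X in detour X).
have perm_c' : perm_eq (z :: c') (x :: c).
  by rewrite /c'; perm_count_from (rot_perm def_c).
have : uniq (z :: c') by rewrite (perm_uniq perm_c') /= xc.
rewrite cons_uniq => /andP [zc' Uc']; split => //.
- apply: (longest_eq_size L) => //; first exact: reroute_cycle def_c bS aS bAg.
  by have := perm_size perm_c'; case.
- move=> o oO; have := perm_mem perm_c' o; rewrite !inE (outer_mem oO) orbT.
  by rewrite eq_sym (negPf (neq_inner_outer zI oO)).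
move=> u v uO vO; have bI := succs_inner bS.
rewrite -(cyc_adj_rot i) // def_c.
have neq y : y \in inner -> (y != u) * (y != v)
  by move=> yI; rewrite !neq_inner_outer.
rewrite !cyc_adj_consec ?neq ?x_inner -?def_c ?rot_uniq //.
rewrite (consec_cat_cons (g :: P) (Q ++ A)) ?neq //.
rewrite rev_cons cat_rcons consec_cat_cons ?neq // consec_rev.
case: A {def_c bAg perm_c' Uc' zc' c'} aS => [|a A] aS;
  first by rewrite cats0 orbC.
have aI := succs_inner aS.
by rewrite rev_cons cat_rcons !consec_cat_cons ?neq // consec_rev orbC orbA.
Qed.

Lemma crossing_split f a b :
  f \in c -> a \in succs c x -> b \in succs c x -> f != b ->
  e a (next c f) -> steps c f b < steps c f a ->
  exists P Q R,
    rot (index f c) c = f :: (next c f :: P) ++ (b :: Q) ++ a :: R /\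
    path e a (rcons R f).
Proof.
move=> fc aS bS fb ag lt_ba.
have steps_lt : 0 < steps c f b < steps c f a by rewrite steps_gt0 ?fb.
have [[|g P] [Q [R def_c]]] := steps_split3 Uc fc (succs_mem aS) steps_lt.
  have := inner_nonadj (succs_inner aS) (succs_inner bS).
  by rewrite -(rot_next_cat (s1 := [::]) Uc def_c) ag.
exists P, Q, R; rewrite (rot_next_cat (s1 := [::]) Uc def_c) def_c; split=> //.
have := Cc; rewrite -(rot_cycle (index f c)) def_c -cat_cons cycle_cat_cons.
case/and4P => _ _; rewrite cat_path last_cat rcons_path /=.
by case/and3P=> _ _ ->.
Qed.

Lemma succs_crossing f a b : f \in c -> a \in succs c x -> b \in succs c x ->
  e a (next c f) -> e b f -> steps c f a <= steps c f b.
Proof.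
move=> fc aS bS ag bf; rewrite leqNgt; apply/negP => lt_ba.
have fb : f != b by apply: contraTneq bf => ->; rewrite eirr.
have [P [Q [R [def_c]]]] := crossing_split fc aS bS fb ag lt_ba.
rewrite rcons_path => /andP [aR Rf].
have path_bg : path e b (rcons (f :: rev (a :: R)) (next c f)).
  by rewrite /= rcons_path path_rev_cons last_rev_cons bf ag aR esym Rf.
move: (reroute_cycle def_c bS aS path_bg); apply/negP.
apply: (longest_no_extension (h := x) (p := [::]) L); first by rewrite /= xc.
by perm_count_from (rot_perm def_c).
Qed.

Lemma crossing_avoidable z a b : z \in c -> z \in inner -> z \notin succs c x ->
  a \in succs c x -> b \in succs c x -> e a (next c z) -> e b (prev c z) ->
  steps c z b < steps c z a -> avoidable z.
Proof.
move=> zc zI zS aS bS ag bf lt_ba.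
have zb : z != b by apply: contraNneq zS => ->.
have [P [Q [R [def_c]]]] := crossing_split zc aS bS zb ag lt_ba.
rewrite rcons_path => /andP [aR _].
rewrite (rot_prev_cons Uc def_c) !last_cat /= in bf.
exists (x :: rev (b :: Q) ++ rev (a :: R) ++ next c z :: P).
apply: detour_reroute def_c _ _ _ _ => //.
by rewrite rcons_path path_rev_cons last_rev_cons bf aR.
Qed.

Lemma succs_detour a b : a \in succs c x -> b \in succs c x -> b != a ->
  e (next c a) b -> exists P Q,
  [/\ rot (index a c) c = (a :: next c a :: P) ++ b :: Q
     & detour (x :: rev (b :: Q) ++ next c a :: P) a].
Proof.
move=> aS bS ba gb; rewrite eq_sym in ba.
have [aI bI] := (succs_inner aS, succs_inner bS).
have [[|g P] [Q def_c]] := rot_split2 (succs_mem aS) (succs_mem bS) ba.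
  have := inner_nonadj bI bI.
  by rewrite -{1}(rot_next_cat (s1 := [::]) Uc def_c) gb.
have def_g := rot_next_cat (s1 := [::]) Uc def_c.
exists P, Q; rewrite {}def_g in gb *; split => //.
apply: (detour_reroute (i := index a c) (A := [::]));
  rewrite ?cats0 //= esym gb //.
Qed.

Lemma succs_avoidable a : a \in succs c x -> avoidable a.
Proof.
move=> aS; have [b [bS ba gb]] := next_succ_nbr aS.
by have [P [Q [_ detour_a]]] := succs_detour aS bS ba gb; eexists;
  apply: detour_a.
Qed.

Lemma frame_avoidable y : y \in frame c x -> avoidable y.
Proof.
by rewrite in_setU inE => /orP [/off_avoidable|/succs_avoidable].
Qed.

Definition runs := [set f in outer | next c f \in outer].

Lemma runsP f : reflect (f \in outer /\ next c f \in outer) (f \in runs).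
Proof. by rewrite [f \in runs]inE; apply: andP. Qed.

Lemma run_no_common_nbr f z : f \in runs -> avoidable z -> e f z ->
  ~~ e (next c f) z.
Proof.
move=> /runsP [fO gO] [c' [L' zc' _ adj]]; rewrite ![e _ z]esym => zf.
have : cyc_adj c' f (next c f) by rewrite -adj // /cyc_adj !outer_mem ?eqxx.
case/and3P => fc' gc' nfg; apply/negP => zg.
have Uc' : uniq c' by case: L'.
case/orP: nfg => /eqP nfg.
  by apply: (no_bridge_next L' fc'); rewrite nfg; apply: bridge1 zf zg.
by apply: (no_bridge_next L' gc'); rewrite nfg; apply: bridge1 zg zf.
Qed.

Lemma outer_frame_bound u : u \in outer ->
  #|frame c x| < #|[set s in succs c x | e u s]| +
    #|[set z in off c | e u z]| + k.
Proof.
move=> uO; have := outer_nonnbrs_card frame_inner uO.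
have -> : [set z in frame c x | ~~ e u z] = frame c x :\: [set z | e u z].
  by apply/setP => z; rewrite in_setD inE [z \in [set _ | _]]inE andbC.
rewrite -[in X in _ -> X](cardsID [set z | e u z] (frame c x)).
suff : #|frame c x :&: [set z | e u z]|
    <= #|[set s in succs c x | e u s]| + #|[set z in off c | e u z]|.
  by card_lia.
apply: leq_trans (leq_card_setU _ _); apply: subset_leq_card;
  apply/subsetP => z.
by rewrite in_setI in_frame !inE => /andP [+ ->]; rewrite !andbT orbC;
  case: (z \in c).
Qed.

Lemma run_off_nbrs_card f : f \in runs ->
  #|[set z in off c | e f z]| + #|[set z in off c | e (next c f) z]|
    <= #|off c|.
Proof.
move=> fR; rewrite -cardsUI [_ :&: _](_ : _ = set0) ?cards0 ?addn0.
  apply/subset_leq_card/subsetP => z.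
  by rewrite !inE -andb_orr => /andP [].
apply/setP => z; rewrite !inE.
apply/negP => /andP [/andP [zc fz] /andP [_ wz]].
by have := run_no_common_nbr fR (off_avoidable zc) fz; rewrite wz.
Qed.

(* Seen from [f] along the cycle, the neighbours of [next c f] in [succs c x]
   precede those of [f]; if these preceded those of [o], the three sets would
   not fit into [succs c x]. *)
Lemma run_nbr_before f o : f \in runs -> o \in outer -> ~~ e x o ->
  exists a b, [/\ a \in succs c x, b \in succs c x, e f a, e o b
    & steps c f b < steps c f a].
Proof.
move=> fR oO xo; have [fO wO] := runsP _ fR; set w := next c f in wO *.
pose N u := [set s in succs c x | e u s]; pose X u := [set z in off c | e u z].
have in_N u s : (s \in N u) = (s \in succs c x) && e u s by rewrite [LHS]inE.
suff /exists_inP [a aN /exists_inP [b bN lt_ba]] :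
    [exists a in N f, exists b in N o, steps c f b < steps c f a].
  by move: aN bN; rewrite !in_N => /andP [aS fa] /andP [bS ob]; exists a, b.
apply: contraT; rewrite negb_exists_in => /forall_inP none.
have sumN : #|N w| + #|N f| + #|N o| <= #|succs c x|.+1.
  apply: (leq_card_three_ordered (pos := steps c f)).
  - by move=> a b /succs_mem ac /succs_mem bc; apply: steps_inj.
  - by apply/subsetP => z; rewrite !in_setU !in_N -!andb_orr => /andP [].
  - move=> a b; rewrite !in_N => /andP [aS wa] /andP [bS fb].
    rewrite ltn_neqAle succs_crossing 1?esym ?outer_mem // andbT.
    apply/eqP => /(steps_inj (succs_mem aS) (succs_mem bS)) ab.
    by have := run_no_common_nbr fR (succs_avoidable bS) fb; rewrite -ab wa.
  - by have [b bS fb] := outer_succ_nbr fO; apply/set0Pn; exists b;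
    rewrite in_N bS.
  - move=> a b aN bN; rewrite leqNgt; apply/negP => lt_ba.
    by have := none a aN; apply/negP; rewrite negbK; apply/exists_inP; exists b.
have Xo : #|X o| < #|off c|.
  apply: proper_card; apply/properP; split.
    by apply/subsetP => z; rewrite inE => /andP [].
  by exists x; rewrite !inE ?xc // esym (negPf xo).
have := outer_frame_bound oO; have := outer_frame_bound fO.
have := outer_frame_bound wO.
rewrite (card_frame L xc) -(card_succs L xc) -/(N _) -/(X _).
have := deg_bound x; rewrite -(card_succs L xc).
by move: sumN (run_off_nbrs_card fR) Xo; rewrite -/(X _); card_lia.
Qed.

Lemma prev_run_avoidable f : f \in runs ->
  prev c f \in inner /\ avoidable (prev c f).
Proof.
move=> fR; have [fO _] := runsP _ fR; have fc := outer_mem fO.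
case: (boolP (prev c f \in succs c x)) => zS.
  by split; [apply: succs_inner|apply: succs_avoidable].
set z := prev c f in zS *; have nz : next c z = f by rewrite next_prev.
have zc : z \in c by rewrite mem_prev.
have steps_z s : s \in c -> s != z -> steps c z s = (steps c f s).+1.
  by move=> sc sz; rewrite steps_next_l 1?eq_sym ?nz // ltnW.
case: (boolP (z \in inner)) => [zI|]; last rewrite in_setC negbK => zO.
  split => //; have [|a [b [aS bS fa ob lt_ba]]] :=
    run_nbr_before fR (prev_inner_outer zc zI).
    by apply: contra zS => xz; rewrite inE zc.
  apply: (crossing_avoidable zc zI zS aS bS); rewrite ?nz 1?esym //.
  have neq s : s \in succs c x -> s != z
    by move=> sS; apply: contraNneq zS => <-.
  by rewrite !steps_z ?neq ?(succs_mem aS) ?(succs_mem bS).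
have [|a [b [aS bS fa zb lt_ba]]] := run_nbr_before fR zO.
  by apply: next_outer_nonadj; rewrite nz.
have := succs_crossing zc aS bS.
rewrite nz ![e _ z]esym ![e _ f]esym => /(_ fa zb).
have neq s : s \in succs c x -> s != z
  by move/succs_inner/neq_inner_outer; apply.
by rewrite !steps_z ?neq ?(succs_mem aS) ?(succs_mem bS) // ltnS leqNgt lt_ba.
Qed.

Definition core := frame c x :|: [set prev c f | f in runs].

Lemma core_inner : {subset core <= inner}.
Proof.
move=> z /setUP [/frame_inner //|/imsetP [f fR ->]].
by have [] := prev_run_avoidable fR.
Qed.

Lemma core_avoidable z : z \in core -> avoidable z.
Proof.
by case/setUP => [/frame_avoidable //|/imsetP [f fR ->]];
  have [] := prev_run_avoidable fR.
Qed.

Definition twice_missed f := [set z in core | ~~ e f z && ~~ e (next c f) z].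

Lemma core_twice_missed_card f : f \in runs ->
  #|core| + #|twice_missed f| <= 2 * (k - 1).
Proof.
move=> fR; have [fO wO] := runsP _ fR.
have := outer_nonnbrs_card core_inner fO.
have := outer_nonnbrs_card core_inner wO.
set Mw := [set _ in _ | _]; set Mf := [set _ in _ | _].
have <- : Mf :|: Mw = core.
  apply/setP => z.
  rewrite in_setU [z \in Mf]inE [z \in Mw]inE -andb_orr -negb_and.
  case: (boolP (z \in core)) => //= zC; apply/nandP.
  case: (boolP (e f z)) => fz; [right|by left].
  by apply: run_no_common_nbr (core_avoidable zC) fz.
have <- : Mf :&: Mw = twice_missed f.
  by apply/setP => z;
    rewrite in_setI [z \in Mf]inE [z \in Mw]inE [RHS]inE andbACA andbb.
by rewrite cardsUI; card_lia.
Qed.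

Lemma runs_neq0 : 2 * #|inner| <= #|T| -> runs != set0.
Proof.
rewrite -(cardsC outer) -/inner; apply: contraTneq => runs0.
suff : #|outer| < #|inner| by card_lia.
rewrite -(card_imset outer (can_inj (prev_next Uc))).
apply/proper_card/properP; split.
  apply/subsetP => _ /imsetP [o oO ->]; rewrite in_setC; apply/negP => nO.
  by have := in_set0 o; rewrite -runs0 (introT (runsP o)).
exists x; first exact: x_inner.
by apply/imsetP => -[o /outer_mem oc def_x]; case/negP: xc;
  rewrite def_x mem_next.
Qed.

(** * Runs separating two inner vertices *)

Lemma detour_next f z : f \in runs -> avoidable z ->
  exists2 c', detour c' z & next c' f = next c f.
Proof.
move=> /runsP [fO gO] [c' detour_c']; have [L' _ _ adj] := detour_c'.
have Uc' : uniq c' by case: L'.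
have : cyc_adj c' f (next c f) by rewrite -adj // /cyc_adj !outer_mem ?eqxx.
case/and3P => _ _ /orP [] /eqP nf; first by exists c'.
by exists (rev c'); [apply: detour_rev | rewrite next_rev // -{1}nf prev_next].
Qed.

Section Separators.
Variables (c' : seq T) (z l : T).
Hypotheses (detour_z : detour c' z) (zI : z \in inner) (lI : l \in inner).
Hypothesis l_avoidable : avoidable l.
Let L' : longest c'. Proof. by case: detour_z. Qed.
Let Uc' : uniq c'. Proof. by case: L'. Qed.

Definition separators := [set y in frame c' z | e l y].

Lemma separators_card u : e z u -> e l (next c' u) ->
  #|frame c' z| < #|separators| + k.
Proof.
have [_ zc' _ _] := detour_z; move=> zu lnu.
have nuF : next c' u \in frame c' z by rewrite in_frame prev_next // zu orbT.
have := nonnbrs_card (frame_independent L' zc') nuF lnu.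
have -> : [set y in frame c' z | ~~ e l y] = frame c' z :\: separators.
  by apply/setP => y; rewrite [LHS]inE in_setD [y \in separators]inE;
    case: (y \in frame c' z); rewrite ?andbT ?andbF.
have := cardsID separators (frame c' z).
have -> : frame c' z :&: separators = separators.
  by apply/setIidPr/subsetP => y; rewrite inE => /andP [].
by card_lia.
Qed.

Lemma separatorP y : y \in separators ->
  [/\ y \in outer, prev c' y \in outer, e l y & e z (prev c' y)].
Proof.
rewrite inE => /andP [yF ly]; have yO := inner_nbr_outer lI ly.
have [_ _ Oc' _] := detour_z; rewrite in_frame Oc' //= in yF.
by split => //; apply: inner_nbr_outer yF.
Qed.

Definition run_start y := if next c (prev c' y) == y then prev c' y else y.

Variant run_start_spec y : T -> Prop :=
  | ForwardRun of next c (prev c' y) = y : run_start_spec y (prev c' y)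
  | BackwardRun of next c (prev c' y) != y & next c y = prev c' y :
      run_start_spec y y.

Lemma run_startP y : y \in separators -> run_start_spec y (run_start y).
Proof.
move=> /separatorP [yO pO _ _]; have [_ _ Oc' adj] := detour_z.
have : cyc_adj c (prev c' y) y
  by rewrite adj // /cyc_adj !Oc' //= next_prev ?eqxx.
rewrite /run_start; case: eqP => [|/eqP ne]; first by constructor.
by rewrite /cyc_adj (negPf ne) => /and3P [_ _ /eqP]; constructor.
Qed.

Lemma run_start_runs y : y \in separators -> run_start y \in runs.
Proof.
move=> yS; have [yO pO _ _] := separatorP yS; apply/runsP.
by case: (run_startP yS) => [->|_ ->].
Qed.

Lemma run_start_inj : {in separators &, injective run_start}.
Proof.
move=> y y' yS y'S; have [_ _ ly _] := separatorP yS.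
have [_ _ ly' _] := separatorP y'S.
have := run_start_runs y'S; have := run_start_runs yS.
have no_common f : f \in runs -> e l f -> e l (next c f) -> False.
  move=> fR; rewrite ![e l _]esym => fl nfl.
  by have := run_no_common_nbr fR l_avoidable fl; rewrite nfl.
case: (run_startP yS) (run_startP y'S) => [ny|_ ny] [ny'|_ ny'] yR y'R eq_start.
- by rewrite -ny eq_start.
- by case: (no_common (prev c' y) yR); rewrite ?ny // eq_start.
- by case: (no_common y yR) => //; rewrite eq_start ny'.
- exact: eq_start.
Qed.

End Separators.

Lemma run_after_succ : runs != set0 ->
  exists2 f, f \in runs & prev c f \in succs c x.
Proof.
case/set0Pn => f fR; apply/exists_inP; apply: contraT; rewrite negb_exists_in.
move/forall_inP => none; have [fO wO] := runsP _ fR.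
have [j jS fj] := outer_succ_nbr fO; have [l lS wl] := outer_succ_nbr wO.
have [c' detour_j nf] := detour_next fR (succs_avoidable jS).
have [jI lI] := (succs_inner jS, succs_inner lS).
have lw : e l (next c' f) by rewrite nf esym.
have jf : e j f by rewrite esym.
have le_frame' := separators_card detour_j jf lw.
have [L' jc' _ _] := detour_j; have ge_frame' := frame_lower_bound L' jc'.
have le_seps : #|separators c' j l| <= #|[set prev c g | g in runs]|.
  rewrite card_imset; last exact: can_inj (next_prev Uc).
  rewrite -(card_in_imset (run_start_inj detour_j jI lI (succs_avoidable lS))).
  apply: subset_leq_card; apply/subsetP => _ /imsetP [y yS ->].
  exact: (run_start_runs detour_j jI lI yS).
have def_core : #|core| = #|frame c x| + #|[set prev c g | g in runs]|.
  rewrite /core cardsU disjoint_setI0 ?cards0 ?subn0 //.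
  apply/pred0P => y /=; apply/negP => /andP [yF /imsetP [g gR def_y]].
  have [gO _] := runsP _ gR; move: yF (none _ gR).
  by rewrite def_y in_frame inE mem_prev outer_mem //= => ->.
have := core_twice_missed_card fR; have := frame_lower_bound L xc.
by move: le_frame' ge_frame' le_seps def_core; card_lia.
Qed.

Section RunAfterSucc.
Variable r : T.
Hypotheses (rS : r \in succs c x) (vR : next c r \in runs).
Let v := next c r.
Let w := next c v.
Let pos := steps c r.
Let rc : r \in c. Proof. exact: succs_mem rS. Qed.
Let rI : r \in inner. Proof. exact: succs_inner rS. Qed.
Let vO : v \in outer. Proof. by case/runsP: vR. Qed.
Let wO : w \in outer. Proof. by case/runsP: vR. Qed.
Let rv : e r v. Proof. exact: next_cycle. Qed.

Lemma nbr_pos_lt a b : a \in succs c x -> a != r -> e v a ->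
  b \in succs c x -> e w b -> pos b < pos a.
Proof.
rewrite eq_sym => aS ra va bS wb; have [ac bc] := (succs_mem aS, succs_mem bS).
have ba : b != a.
  by apply: contraTneq wb => ->;
    exact: (run_no_common_nbr vR (succs_avoidable aS) va).
have vc : v \in c by rewrite mem_next.
have := succs_crossing vc bS aS.
rewrite ![e _ v]esym ![e _ (next c v)]esym => /(_ wb va) le_ba.
rewrite ltn_neqAle (contra_neq (steps_inj bc ac)) //=.
case: (eqVneq r b) => [<-|rb].
  by rewrite /pos steps_refl // steps_gt0.
by rewrite /pos (steps_next_l Uc _ rc ac ra)
  ?(steps_next_l Uc _ rc bc rb) // ltnW.
Qed.

Lemma separating_pos_lt f l : l \in succs c x -> f \in runs -> e r f ->
  e l (next c f) -> pos f < pos l.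
Proof.
move=> lS fR rf lg; have [fO _] := runsP _ fR.
have [fc lc] := (outer_mem fO, succs_mem lS).
have rl : r != l.
  apply: contraTneq lg => <-; rewrite esym run_no_common_nbr //;
    first exact: succs_avoidable.
  by rewrite esym.
have fl : f != l by rewrite eq_sym (neq_inner_outer (succs_inner lS)).
have rnf : r != f by rewrite neq_inner_outer.
have := succs_crossing fc lS rS lg rf; have := steps_gt0 l rc.
have := steps_gt0 f rc.
have := steps_add Uc rc fc lc; have := steps_add Uc rc fc rc.
rewrite steps_refl //; have : pos f != pos l
  by apply: contra fl => /eqP /(steps_inj fc lc) ->.
have := steps_lt_size r lc; have := steps_lt_size r fc.
rewrite rl rnf -!/(pos _).
move: (pos f) (pos l) (steps c f l) (steps c f r) (size c); clear.
by move=> ? ? ? ? ?; do 2 case: ifP; lia.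
Qed.

Section ExtremalNeighbours.
Variables (a l : T) (P Q : seq T).
Hypotheses (aS : a \in succs c x) (ar : a != r) (va : e v a).
Hypothesis a_max : {in succs c x, forall b, b != r -> e v b -> pos b <= pos a}.
Hypotheses (lS : l \in succs c x) (wl : e w l).
Hypothesis l_min : {in succs c x, forall b, e w b -> pos l <= pos b}.
Hypothesis def_c : rot (index r c) c = (r :: v :: P) ++ a :: Q.
Let c' := x :: rev (a :: Q) ++ v :: P.
Hypothesis detour_r : detour c' r.
Let Uc' : uniq c'. Proof. by case: detour_r => [[]]. Qed.
Let aI : a \in inner. Proof. exact: succs_inner aS. Qed.
Let lI : l \in inner. Proof. exact: succs_inner lS. Qed.

(* The possible predecessors of the runs that the separators start. *)
Definition targets :=
  (core :\: frame c x) :|: [set r; a] :|: (twice_missed v :&: succs c x).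

Lemma far_targets s : s \in succs c x -> (pos s < pos l) || (pos a <= pos s) ->
  s \in targets.
Proof.
move=> sS far; rewrite /targets 2!in_setU in_set2 in_setI sS andbT.
case: (eqVneq s r) => [|sr]; rewrite ?orbT //; case: (eqVneq s a) => [|sa];
  rewrite ?orbT //=.
have {}far : (pos s < pos l) || (pos a < pos s).
  case/orP: far => [->//|]; rewrite leq_eqVlt => /orP [/eqP eq_pos|->];
    last by rewrite orbT.
  by rewrite (steps_inj (succs_mem aS) (succs_mem sS) eq_pos) eqxx in sa.
rewrite orbF [s \in twice_missed v]inE in_setU succs_frame //=.
suff [-> ->] : ~~ e v s /\ ~~ e w s by rewrite orbT.
split; apply/negP => adj; move: far; rewrite !ltnNge.
- by rewrite (a_max sS) // orbF (ltnW (nbr_pos_lt sS sr adj lS wl)).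
- by rewrite (l_min sS adj) (ltnW (nbr_pos_lt aS ar va sS adj)).
Qed.

Lemma prev_detour_head : prev c' v = a.
Proof.
apply: (@rot_prev_cat _ 0 c' (x :: rev Q) a [::] v P Uc').
by rewrite rot0 /c' rev_cons cat_rcons.
Qed.

Lemma prev_detour_tail y : y \in P -> prev c' y = prev c y.
Proof.
move=> yP; have [P1 [P2 def_P]] : exists P1 P2, P = P1 ++ y :: P2.
  by case/splitPr: yP => P1 P2; exists P1, P2.
rewrite (@rot_prev_cat _ 0 c' (x :: rev (a :: Q)) v P1 y P2 Uc') ?rot0 /c'
  ?def_P //.
symmetry; apply:
  (@rot_prev_cat _ (index r c) c [:: r] v P1 y (P2 ++ a :: Q) Uc).
by rewrite def_c def_P /= -catA.
Qed.

Lemma backward_run_pos y : y \in outer -> next c (prev c' y) != y ->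
  next c y = prev c' y -> pos a < pos y.
Proof.
move=> yO ne_y ny; have aNy := neq_inner_outer aI yO.
have yQ : y \in Q.
  have [_ _ Oc' _] := detour_r; move: (Oc' y yO).
  rewrite inE eq_sym (negPf (neq_inner_outer x_inner yO)) mem_cat mem_rev !inE.
  rewrite eq_sym (negPf aNy) /=; case/or3P => // [/eqP y_v|yP]; exfalso.
    have := neq_inner_outer aI wO.
    by rewrite -prev_detour_head /w -y_v -ny eqxx.
  by rewrite prev_detour_tail // next_prev ?eqxx in ne_y.
have : uniq (rot (index r c) c) by rewrite rot_uniq.
rewrite def_c cat_uniq => /and3P [_ /hasPn disj _].
have /negPf aNrP : a \notin r :: v :: P by apply: disj; rewrite mem_head.
have /negPf yNrP : y \notin r :: v :: P by apply: disj; rewrite inE yQ orbT.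
by rewrite /pos /steps def_c !index_cat aNrP yNrP /= eqxx (negPf aNy) addn0
  addnS ltnS leq_addr.
Qed.

Lemma separator_targets y : y \in separators c' r l ->
  prev c (run_start c' y) \in targets.
Proof.
move=> yS; have sR := run_start_runs detour_r rI lI yS.
have [sO _] := runsP _ sR.
have [yO _ ly rp] := separatorP detour_r rI lI yS.
have sC : prev c (run_start c' y) \in core
  by apply/setUP; right; apply: imset_f.
have sc : prev c (run_start c' y) \in c by rewrite mem_prev outer_mem.
case: (boolP (prev c (run_start c' y) \in frame c x)) => sF; last first.
  by rewrite !in_setU in_setD sF sC.
apply: far_targets; first by move: sF; rewrite in_frame inE sc.
have := steps_prev_r Uc (ltnW size_c) rc (outer_mem sO) (neq_inner_outer rI sO).
rewrite -!/(pos _) => pos_s; apply/orP.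
move: sR pos_s; case: (run_startP detour_r rI lI yS) => [ny|ne_y ny] sR pos_s.
  by left; apply: ltnW; rewrite -pos_s; apply: separating_pos_lt; rewrite ?ny.
by right; rewrite -ltnS -pos_s; apply: backward_run_pos.
Qed.

Lemma targets_card : #|targets| + #|frame c x| + ~~ e x w
  <= #|core| + #|twice_missed v| + 2.
Proof.
have le_targets : #|targets| <=
    #|core :\: frame c x| + 2 + #|twice_missed v :&: succs c x|.
  apply: leq_trans (leq_card_setU _ _) _; rewrite leq_add2r.
  apply: leq_trans (leq_card_setU _ _) _; rewrite leq_add2l.
  by rewrite cards2; case: eqP.
have card_core : #|core| = #|frame c x| + #|core :\: frame c x|.
  rewrite -(cardsID (frame c x) core); congr (#|pred_of_set _| + _).
  exact/setIidPr/subsetUl.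
have le_missed : #|twice_missed v :&: succs c x| + ~~ e x w
  <= #|twice_missed v|.
  case: (boolP (e x w)) => xw; rewrite ?addn0 ?addn1.
    exact: subset_leq_card (subsetIl _ _).
  apply: proper_card; apply/properP; split; first exact: subsetIl.
  exists x; last by rewrite in_setI negb_and [x \in succs c x]inE
    (negPf xc) orbT.
  rewrite inE in_setU x_frame //= ![e _ x]esym xw andbT.
  exact: next_outer_nonadj.
by move: le_targets card_core le_missed; case: (e x w) => /=; card_lia.
Qed.

Lemma next_detour_head : next c' v = w.
Proof.
have := def_c; case def_P : P => [|w' P1] def_c'.
  have := neq_inner_outer aI wO.
  by rewrite -(rot_next_cat (s1 := [:: r]) Uc def_c') eqxx.
rewrite /w (rot_next_cat (s1 := [:: r]) Uc def_c').
by apply: (@rot_next_cat _ 0 c' (x :: rev (a :: Q)) P1 v w' Uc');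
  rewrite rot0 /c' def_P.
Qed.

Definition run_start_prevs :=
  [set prev c (run_start c' y) | y in separators c' r l].

Lemma run_start_prevs_targets : run_start_prevs \subset targets.
Proof.
by apply/subsetP => _ /imsetP [y yS ->]; apply: separator_targets.
Qed.

Lemma run_start_prevs_card : 3 * (k - 1) + 4 <= 2 * (#|run_start_prevs| + k).
Proof.
have [L' rc' _ _] := detour_r.
have lw : e l (next c' v) by rewrite next_detour_head esym.
have := separators_card detour_r rv lw; have := frame_lower_bound L' rc'.
rewrite card_in_imset => [|y z yS zS /(can_inj (next_prev Uc))];
  first by card_lia.
exact: (run_start_inj detour_r rI lI (succs_avoidable lS)).
Qed.

Lemma targets_tight :
  [/\ 2 * #|frame c x| = 3 * (k - 1) + 2, e x w,
      #|core| + #|twice_missed v| = 2 * (k - 1) & run_start_prevs = targets].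
Proof.
have := run_start_prevs_card; have := targets_card.
have := core_twice_missed_card vR.
have := frame_lower_bound L xc; have := subset_leq_card run_start_prevs_targets.
case xw: (e x w) => /=; last by card_lia.
move=> le_prevs le_frame le_core le_targets lt_prevs; split=> //.
- by move: le_prevs le_frame le_core le_targets lt_prevs; card_lia.
- by move: le_prevs le_frame le_core le_targets lt_prevs; card_lia.
apply/eqP; rewrite eqEcard run_start_prevs_targets.
by move: le_prevs le_frame le_core le_targets lt_prevs; card_lia.
Qed.

Lemma last_succ_run r' : r' \in succs c x ->
  {in succs c x, forall b, pos b <= pos r'} -> next c r' \in runs.
Proof.
move=> r'S r'_max; have [_ _ _ def_targets] := targets_tight.
have : r' \in targets by apply: far_targets; rewrite ?r'_max ?orbT.
rewrite -def_targets => /imsetP [y yS ->]; rewrite next_prev //.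
exact: (run_start_runs detour_r rI lI yS).
Qed.

End ExtremalNeighbours.

Lemma run_after_succ_tight :
  [/\ 2 * #|frame c x| = 3 * (k - 1) + 2, e x w,
      #|core| + #|twice_missed v| = 2 * (k - 1) &
      exists r', [/\ r' \in succs c x, next c r' \in runs &
        {in succs c x, forall a, pos a <= pos r'}]].
Proof.
pose v_nbr := [pred b | [&& b \in succs c x, b != r & e v b]].
have [b vb] : exists b, v_nbr b.
  by have [b [bS br vb]] := next_succ_nbr rS; exists b; apply/and3P.
pose w_nbr := [pred b | (b \in succs c x) && e w b].
have [d wd] : exists d, w_nbr d
  by have [d dS wd] := outer_succ_nbr wO; exists d; apply/andP.
have [a /and3P [aS ar va] le_a] := arg_maxnP pos vb.
have [l /andP [lS wl] ge_l] := arg_minnP pos wd.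
have a_max : {in succs c x, forall b, b != r -> e v b -> pos b <= pos a}.
  by move=> y yS yr vy; apply: le_a; apply/and3P.
have l_min : {in succs c x, forall b, e w b -> pos l <= pos b}.
  by move=> y yS wy; apply: ge_l; apply/andP.
have [P [Q [def_c detour_r]]] := succs_detour rS aS ar va.
have [eq_frame xw eq_core _] :=
  targets_tight aS ar va a_max lS wl l_min def_c detour_r.
split=> //; have [r' r'S r'_max] := arg_maxnP pos rS.
exists r'; split=> //.
exact: (last_succ_run aS ar va a_max lS wl l_min def_c detour_r r'S r'_max).
Qed.

End RunAfterSucc.

(** * The tight case *)

Definition triple_heads := [set r in succs c x | next c r \in runs].

Lemma triple_headsP r : r \in triple_heads ->
  [/\ r \in succs c x, next c r \in runs, next c r \in outer
    & next c (next c r) \in outer].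
Proof.
by rewrite inE => /andP [rS rR]; have [vO wO] := runsP _ rR.
Qed.

Lemma triple_heads_nbr r : r \in triple_heads -> e x (next c (next c r)).
Proof.
by case/triple_headsP => rS rR _ _; have [] := run_after_succ_tight rS rR.
Qed.

Lemma triple_heads_prev3 r : r \in triple_heads ->
  prev c (prev c (prev c r)) \in triple_heads.
Proof.
case/triple_headsP => rS rR _ _; have rI := succs_inner rS.
have [_ _ _ [r' [r'S r'R r'_max]]] := run_after_succ_tight rS rR.
have r'H : r' \in triple_heads by rewrite inE r'S.
have [_ _ vO wO] := triple_headsP r'H; have xw := triple_heads_nbr r'H.
suff <- : next c (next c (next c r')) = r by rewrite !prev_next.
apply/eqP; apply: contraT => ne_r; have := r'_max _ (next_nbr L xc xw).
have rc := succs_mem rS; have size1 := ltnW size_c.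
rewrite !steps_next_r ?mem_next ?(succs_mem r'S) // 1?eq_sym
  ?neq_inner_outer //.
by rewrite ltnNge ltnW // ltnW.
Qed.

Section Tight.
Hypothesis headsN0 : triple_heads != set0.

Lemma mem_triple y : y \in c ->
  [|| y \in triple_heads, prev c y \in triple_heads
    | prev c (prev c y) \in triple_heads].
Proof.
case/set0Pn: headsN0 => r rH yc; have [rS _ _ _] := triple_headsP rH.
have prev_cyc : fcycle (prev c) (rev c).
  rewrite -(eq_cycle (e := frel (next (rev c)))).
    by apply: cycle_next; rewrite rev_uniq.
  by move=> u w /=; rewrite next_rev.
have rc : r \in rev c by rewrite mem_rev (succs_mem rS).
have : fconnect (prev c) r y by rewrite (fconnect_cycle prev_cyc rc) mem_rev.
move/iter_findex => <-; elim: (findex _ _ _) => [|n IHn] /=;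
  first by rewrite rH.
case/or3P: IHn => headH; rewrite ?headH ?orbT //.
by rewrite triple_heads_prev3 ?orbT.
Qed.

Lemma succs_triple_heads : {subset succs c x <= triple_heads}.
Proof.
move=> s sS; have sI := succs_inner sS.
case/or3P: (mem_triple (succs_mem sS)) => // /triple_headsP [_ _ vO wO].
  by have := neq_inner_outer sI vO; rewrite next_prev ?eqxx.
by have := neq_inner_outer sI wO; rewrite !next_prev ?eqxx.
Qed.

Lemma runs_triple_heads f : f \in runs -> prev c f \in triple_heads.
Proof.
move=> /runsP [fO gO]; case/or3P: (mem_triple (outer_mem fO)) => // fH.
  have [fS _ _ _] := triple_headsP fH.
  by have := neq_inner_outer (succs_inner fS) fO; rewrite eqxx.
have := triple_heads_nbr fH; rewrite !next_prev // => xf.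
by have := next_outer_nonadj gO; rewrite xf.
Qed.

Lemma core_frame : core = frame c x.
Proof.
apply/setUidPl/subsetP => _ /imsetP [f /runs_triple_heads fH ->].
by have [fS _ _ _] := triple_headsP fH; apply: succs_frame.
Qed.

Lemma tight_degree : #|off c| = 1 /\ 2 * deg e x = 3 * (k - 1).
Proof.
case/set0Pn: headsN0 => r rH; have [rS rR _ _] := triple_headsP rH.
have [eq_frame _ _ _] := run_after_succ_tight rS rR.
have := deg_bound x; have := card_off_gt0 xc; move: eq_frame.
by rewrite (card_frame L xc); move: (card _) (deg _ _) => m d; lia.
Qed.

Lemma deg_le_succs a : #|succs c x| <= deg e a.
Proof.
have [_ eq_deg] := tight_degree.
by rewrite (card_succs L xc) -(leq_pmul2l (m := 2)) // eq_deg.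
Qed.

Definition triple_head o :=
  if prev c o \in succs c x then prev c o else prev c (prev c o).

Lemma triple_headP o : o \in outer -> triple_head o \in succs c x /\
  (o = next c (triple_head o) \/ o = next c (next c (triple_head o))).
Proof.
move=> oO; rewrite /triple_head; case: ifP => pS.
  by split; last by left; rewrite next_prev.
split; last by right; rewrite !next_prev.
case/or3P: (mem_triple (outer_mem oO)) => /triple_headsP [headS _ _ _] //.
  by have := neq_inner_outer (succs_inner headS) oO; rewrite eqxx.
by rewrite headS in pS.
Qed.

Lemma triple_head_inj a : a \in succs c x ->
  {in [set o | e a o] &, injective triple_head}.
Proof.
move=> aS; have aI := succs_inner aS.
move=> o o'; rewrite !inE => ao ao' eq_head.
have [hS ho] := triple_headP (inner_nbr_outer aI ao).
have [_ ho'] := triple_headP (inner_nbr_outer aI ao'); rewrite -eq_head in ho'.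
have [_ hR _ _] := triple_headsP (succs_triple_heads hS).
have no_common := run_no_common_nbr hR (succs_avoidable aS).
rewrite ![e _ a]esym in no_common.
case: ho ho' => def_o [] def_o'.
- by rewrite def_o def_o'.
- by move: no_common; rewrite -def_o' -def_o ao ao' => /(_ isT).
- by move: no_common; rewrite -def_o -def_o' ao ao' => /(_ isT).
- by rewrite def_o def_o'.
Qed.

(* [a] has at least [deg e x] neighbours, at most one in each of the [deg e x]
   triples. *)
Lemma succ_adj_run a r : a \in succs c x -> r \in triple_heads ->
  e a (next c r) || e a (next c (next c r)).
Proof.
move=> aS rH; have aI := succs_inner aS; have [rS _ _ _] := triple_headsP rH.
have heads_sub : triple_head @: [set o | e a o] \subset succs c x.
  by apply/subsetP => _ /imsetP [o + ->];
    rewrite inE => /(inner_nbr_outer aI) /triple_headP [].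
have : r \in triple_head @: [set o | e a o].
  suff -> : triple_head @: [set o | e a o] = succs c x by [].
  apply/eqP; rewrite eqEcard heads_sub card_in_imset ?deg_le_succs //.
  exact: triple_head_inj.
case/imsetP => o; rewrite inE => ao ->.
have [_ [<-|<-]] := triple_headP (inner_nbr_outer aI ao); by rewrite ao ?orbT.
Qed.

Lemma k_eq3 : k = 3.
Proof.
case/set0Pn: headsN0 => r rH; have [rS rR _ _] := triple_headsP rH.
have [eq_frame xw eq_core _] := run_after_succ_tight rS rR.
have missed0 : twice_missed (next c r) = set0.
  apply/setP => z; rewrite [LHS]inE in_set0 core_frame in_setU.
  apply/negP => /and3P [/orP [zoff|zS] vz wz].
    have /eqP/cards1P [t off_t] : #|off c| = 1 by have [] := tight_degree.
    have /set1P def_x : x \in [set t] by rewrite -off_t inE.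
    by move: zoff wz; rewrite off_t => /set1P ->; rewrite -def_x esym xw.
  by have := succ_adj_run zS rH; rewrite ![e z _]esym (negPf vz) (negPf wz).
move: eq_frame eq_core; rewrite missed0 cards0 core_frame.
by move: (card _) => n; lia.
Qed.

Lemma cycle_triples :
  [set y in c] = succs c x :|:
    (next c @: succs c x :|: next c @: (next c @: succs c x)).
Proof.
apply/setP => y; rewrite inE !in_setU; apply/idP/or3P => [yc|].
  case/or3P: (mem_triple yc) => /triple_headsP [headS _ _ _].
  - by apply: Or31.
  - by apply: Or32; rewrite -[y](next_prev Uc); apply: imset_f.
  - by apply: Or33;
    rewrite -[y](next_prev Uc) -[prev c y](next_prev Uc) !imset_f.
case=> [/succs_mem //|/imsetP [s sS ->]|/imsetP [_ /imsetP [s sS ->] ->]];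
  by rewrite !mem_next (succs_mem sS).
Qed.

Lemma size_cycle : size c = 3 * deg e x.
Proof.
have nextI := can_inj (prev_next Uc).
have heads s (sS : s \in succs c x) := triple_headsP (succs_triple_heads sS).
have -> : size c = #|[set y in c]|
  by rewrite cardsE; symmetry; apply/card_uniqP.
rewrite cycle_triples !cardsU !disjoint_setI0 ?cards0 ?subn0 ?card_imset //.
- by rewrite (card_succs L xc); lia.
- apply/pred0P => y /=; apply/negP => /andP [yS]; have yI := succs_inner yS.
  rewrite in_setU =>
    /orP [/imsetP [s sS def_y]|/imsetP [_ /imsetP [s sS ->] def_y]];
    have [_ _ vO wO] := heads s sS.
  + by have := neq_inner_outer yI vO; rewrite def_y eqxx.
  + by have := neq_inner_outer yI wO; rewrite def_y eqxx.
apply/pred0P => y /=.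
apply/negP => /andP [/imsetP [s sS ->] /imsetP [_ /imsetP [t tS ->]]].
move/nextI => def_s; have [_ _ tO _] := heads t tS.
by have := neq_inner_outer (succs_inner sS) tO; rewrite def_s eqxx.
Qed.

End Tight.

End LongestCycle.

(** * From the nonagon to the Petersen graph *)

Definition spoked_nonagon x (s : seq T) :=
  [/\ longest s, size s = 9, x \notin s
    & {in [:: 2; 5; 8], forall i, e x (nth x s i)}].

Lemma exists_spoked_nonagon c x : longest c -> x \notin c ->
  triple_heads c x != set0 ->
  exists i, spoked_nonagon x (rot i c).
Proof.
move=> L xc headsN0; have [Uc _ _ _] := L.
have size_c : size c = 9.
  have [_ deg_x] := tight_degree L xc headsN0.
  rewrite (size_cycle L xc headsN0).
  by rewrite (k_eq3 L xc headsN0) in deg_x; lia.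
have heads_next3 r :
    r \in triple_heads c x -> iter 3 (next c) r \in triple_heads c x.
  move=> rH; apply: (succs_triple_heads L xc headsN0).
  exact: (next_nbr L xc (triple_heads_nbr L xc rH)).
have [r rH] := set0Pn _ headsN0; have [rS _ _ _] := triple_headsP rH.
exists (index r c); split; rewrite ?size_rot ?mem_rot //;
  first exact: longest_rot.
move=> i i258; rewrite nth_rot_index ?size_c ?(succs_mem rS) //; last first.
  by move: i258; rewrite !inE => /or3P [] /eqP ->.
move: i258; rewrite !inE => /or3P [] /eqP ->.
- exact: (triple_heads_nbr L xc rH).
- exact: (triple_heads_nbr L xc (heads_next3 _ rH)).
- exact: (triple_heads_nbr L xc (heads_next3 _ (heads_next3 _ rH))).
Qed.

Lemma spoked_nonagon_rot3 x (s : seq T) : spoked_nonagon x s ->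
  spoked_nonagon x (rot 3 s).
Proof.
case=> L size_s xs spokes; split; rewrite ?size_rot ?mem_rot //;
  first exact: longest_rot.
case: s size_s spokes {L xs} =>
  [|s0 [|s1 [|s2 [|s3 [|s4 [|s5 [|s6 [|s7 [|s8 [|]]]]]]]]]] //.
move=> _ spokes i; rewrite !inE => /or3P [] /eqP ->.
- exact: (spokes 5).
- exact: (spokes 8).
- exact: (spokes 2).
Qed.

Lemma spoked_nonagon_rev x (s : seq T) :
  spoked_nonagon x s -> spoked_nonagon x (rot 1 (rev s)).
Proof.
case=> L size_s xs spokes; split;
  rewrite ?size_rot ?size_rev ?mem_rot ?mem_rev //.
  exact/longest_rot/longest_rev.
case: s size_s spokes {L xs} =>
  [|s0 [|s1 [|s2 [|s3 [|s4 [|s5 [|s6 [|s7 [|s8 [|]]]]]]]]]] //.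
move=> _ spokes i; rewrite !inE => /or3P [] /eqP ->.
- exact: (spokes 5).
- exact: (spokes 2).
- exact: (spokes 8).
Qed.

Section SpokedNonagon.
Variables x s0 s1 s2 s3 s4 s5 s6 s7 s8 : T.
Let s := [:: s0; s1; s2; s3; s4; s5; s6; s7; s8].
Hypothesis spoked : spoked_nonagon x s.
Let L : longest s. Proof. by case: spoked. Qed.
Let xs : x \notin s. Proof. by case: spoked. Qed.
Let U : uniq s. Proof. by case: L. Qed.
Let spoke i : i \in [:: 2; 5; 8] -> e x (nth x s i).
Proof. by case: spoked => _ _ _; apply. Qed.

Lemma nonagon_edges :
  [/\ e s0 s1, e s1 s2, e s2 s3, e s3 s4 & e s4 s5] /\
    [/\ e s5 s6, e s6 s7, e s7 s8 & e s8 s0].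
Proof. by case: L => _ + _ _; rewrite /= andbT; do ?case/andP=> ->. Qed.

Lemma nonagon_succs :
  [/\ s0 \in succs s x, s3 \in succs s x & s6 \in succs s x].
Proof.
have n2 : next s s2 = s3 by apply: (@rot_next_cat _ 0 s [:: s0; s1]).
have n5 : next s s5 = s6
  by apply: (@rot_next_cat _ 0 s [:: s0; s1; s2; s3; s4]).
have n8 : next s s8 = s0.
  by have <- : prev s s0 = s8 := rot_prev_cons U (rot0 s); rewrite next_prev.
split; first by rewrite -n8; apply: (next_nbr L xs (spoke (i := 8) isT)).
- by rewrite -n2; apply: (next_nbr L xs (spoke (i := 2) isT)).
- by rewrite -n5; apply: (next_nbr L xs (spoke (i := 5) isT)).
Qed.

Lemma nonagon_run : s1 \in runs s x /\ next s s1 = s2.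
Proof.
have n0 : next s s0 = s1 by apply: (@rot_next_cat _ 0 s [::]).
have n1 : next s s1 = s2 by apply: (@rot_next_cat _ 0 s [:: s0]).
have [S0 _ _] := nonagon_succs; split => //; apply/runsP; rewrite n1; split.
  by rewrite -n0 next_inner_outer ?(succs_mem S0) ?(succs_inner L xs).
exact: (inner_nbr_outer L xs (x_inner L xs) (spoke (i := 2) isT)).
Qed.

Lemma nonagon_nonadj :
  [/\ ~~ e s2 s0, ~~ e s1 s3, ~~ e s0 s3, ~~ e x s0 & ~~ e x s1].
Proof.
have [[e01 _ e23 _ _] _] := nonagon_edges; have [S0 S3 _] := nonagon_succs.
have [s1R n1] := nonagon_run; have [_ s2O] := runsP _ _ _ s1R.
have ind := independentP _ (frame_independent L xs).
have F0 := succs_frame S0; have F3 := succs_frame S3.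
split.
- rewrite -n1; apply: (run_no_common_nbr L xs s1R (succs_avoidable L xs S0)).
  by rewrite esym.
- apply/negP => e13.
  have := run_no_common_nbr L xs s1R (succs_avoidable L xs S3) e13.
  by rewrite n1 e23.
- exact: ind.
- exact: (ind _ _ (x_frame xs) F0).
- exact: (next_outer_nonadj L xs s2O).
Qed.

Hypothesis k3 : k = 3.

Lemma nonagon_chord : e s1 s6 /\ ~~ e s2 s6.
Proof.
have [_ e13 _ _ ex1] := nonagon_nonadj; have [_ S3 S6] := nonagon_succs.
have [s1R n1] := nonagon_run; have [s1O _] := runsP _ _ _ s1R.
have [x3 x6] : x != s3 /\ x != s6.
  by split; apply: contraNneq xs => ->;
    [exact: succs_mem S3 | exact: succs_mem S6].
have s36 : s3 != s6.
  by have := nth_uniq x (isT : 3 < size s) (isT : 6 < size s) U;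
    rewrite /= => ->.
have e16 : e s1 s6.
  have inner_xss : {subset [set x; s3; s6] <= inner s x}.
    move=> z; rewrite in_setU in_set2 in_set1 -orbA => /or3P [] /eqP ->.
    - exact: (x_inner L xs).
    - exact: (succs_inner L xs S3).
    - exact: (succs_inner L xs S6).
  have [|z] := outer_nbr_in L xs inner_xss s1O.
    by rewrite k3 -setUA cardsU1 cards2 !inE negb_or x3 x6 s36.
  rewrite !inE -orbA => /or3P [] /eqP -> //.
    by rewrite esym (negPf ex1).
  by rewrite (negPf e13).
split=> //; rewrite -n1.
exact: (run_no_common_nbr L xs s1R (succs_avoidable L xs S6)).
Qed.

Lemma nonagon_spoke_ends : e s4 s0 -> e s7 s3 -> ~~ e s8 s2.
Proof.
move=> e40 e73; have [[e01 e12 e23 e34 e45] [e56 e67 e78 e80]] := nonagon_edges.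
have [x5 x8] := (spoke (i := 5) isT, spoke (i := 8) isT); apply/negP => e82.
have perm_xs : perm_eq [:: x; s8; s2; s1; s0; s4; s3; s7; s6; s5] ([:: x] ++ s).
  by perm_count_from (perm_refl s).
have Uxs : uniq ([:: x] ++ s) by rewrite cons_uniq xs U.
move/negP: (longest_no_extension L Uxs perm_xs); apply.
by rewrite /=; do !(apply/andP; split) => //; rewrite esym.
Qed.

End SpokedNonagon.

Lemma petersen_of_spoked_nonagon x (s : seq T) : k = 3 -> #|T| = 10 ->
  spoked_nonagon x s -> is_petersen e.
Proof.
move=> k3 card_T spoked; have [[U _ _ _] size_s xs _] := spoked.
case: s size_s U xs spoked =>
  [|s0 [|s1 [|s2 [|s3 [|s4 [|s5 [|s6 [|s7 [|s8 [|]]]]]]]]]] //.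
move=> _ U xs spoked.
have spoked3 := spoked_nonagon_rot3 spoked.
have spoked6 := spoked_nonagon_rot3 spoked3.
have rev_spoked := spoked_nonagon_rev spoked.
have rev_spoked3 := spoked_nonagon_rot3 rev_spoked.
have rev_spoked6 := spoked_nonagon_rot3 rev_spoked3.
(* By symmetry, the following facts decide all 45 pairs of vertices. *)
have [[? ? ? ? ?] [? ? ? ?]] := nonagon_edges spoked.
have [? ? ?] : [/\ e x s2, e x s5 & e x s8].
  by case: spoked => _ _ _ sp; split;
    [apply: (sp 2)|apply: (sp 5)|apply: (sp 8)].
have [? ? ? ? ?] := nonagon_nonadj spoked.
have [? ?] := nonagon_chord spoked k3.
have [? ? ? ? ?] := nonagon_nonadj spoked3.
have [? ?] := nonagon_chord spoked3 k3.
have [? ? ? ? ?] := nonagon_nonadj spoked6.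
have [? ?] := nonagon_chord spoked6 k3.
have [? _ ? _ _] := nonagon_nonadj rev_spoked.
have [_ ?] := nonagon_chord rev_spoked k3.
have [? _ ? _ _] := nonagon_nonadj rev_spoked3.
have [_ ?] := nonagon_chord rev_spoked3 k3.
have [? _ ? _ _] := nonagon_nonadj rev_spoked6.
have [_ ?] := nonagon_chord rev_spoked6 k3.
have ? : ~~ e s8 s2 by apply: (nonagon_spoke_ends spoked).
have ? : ~~ e s2 s5 by apply: (nonagon_spoke_ends spoked3).
have ? : ~~ e s5 s8 by apply: (nonagon_spoke_ends spoked6).
pose vs := [:: x; s0; s1; s2; s3; s4; s5; s6; s7; s8].
apply: (@is_petersen_of_enum _ _ x vs) => //; first by rewrite cons_uniq xs U.
case=> [|[|[|[|[|[|[|[|[|[|i]]]]]]]]]];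
  case=> [|[|[|[|[|[|[|[|[|[|j]]]]]]]]]] // _ _;
  rewrite [RHS]pair_vertex_adj /=;
  first [assumption | rewrite esym; assumption
    | apply: negbTE; assumption | apply: negbTE; rewrite esym; assumption].
Qed.

Lemma petersen_of_nonspanning c x : longest c -> x \notin c ->
  2 * alpha e <= #|T| ->
  is_petersen e.
Proof.
move=> L xc le_alpha; have [Uc _ _ _] := L.
have runsN0 : runs c x != set0.
  apply: runs_neq0 => //; apply: leq_trans le_alpha; rewrite leq_mul2l /=.
  exact/independent_leq_alpha/inner_independent.
have [f fR fS] := run_after_succ L xc runsN0.
have headsN0 : triple_heads c x != set0.
  by apply/set0Pn; exists (prev c f); rewrite inE fS next_prev.
have [i spoked] := exists_spoked_nonagon L xc headsN0.
have k3 := k_eq3 L xc headsN0; have [off1 deg_x] := tight_degree L xc headsN0.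
apply: (petersen_of_spoked_nonagon k3 _ spoked).
have := size_cycle L xc headsN0; move: deg_x; rewrite k3 -(cardsC [set y in c]).
rewrite (_ : ~: [set y in c] = off c) ?off1; last first.
  by apply/setP => y; rewrite !inE.
by rewrite cardsE (card_uniqP Uc); lia.
Qed.

End K2kK1Free.

End Graph.

Theorem theorem1p6 (T : finType) (e : rel T) (k : nat) :
  simple_graph e ->
  2 <= k ->
  k_connected k e ->
  K2_kK1_free k e ->
  3 * (k - 1) <= 2 * min_degree e ->
  2 * alpha e <= #|T| ->
  hamiltonian e \/ is_petersen e.
Proof.
move=> [esym eirr] k2 conn free le_deg le_alpha.
have deg_bound v : 3 * (k - 1) <= 2 * deg e v.
  by apply: leq_trans le_deg _; rewrite leq_mul2l min_degree_leq orbT.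
have [c L] : exists c, longest e c.
  apply: exists_longest => // [|v].
    by have [kT _] := conn; apply: leq_trans kT.
  exact: leq_trans k2 (k_connected_deg esym eirr v conn).
have [Uc Cc size_c _] := L.
case: (eqVneq (size c) #|T|) => [spanning|not_spanning];
  first by left; exists c.
right; have [x xc] : exists x, x \notin c.
  apply/existsP; rewrite -negb_forall.
  apply: contraNN not_spanning => /forallP all_c.
  by rewrite -(card_uniqP Uc); apply/eqP/eq_card => y; rewrite all_c.
exact: (petersen_of_nonspanning esym eirr free conn deg_bound L xc le_alpha).
Qed.
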